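(* (i) $\mathsf{BIM}\vdash\mathsf{MP}_1\leftrightarrow\forall\alpha\bigl[\forall\zeta\in[\omega]^\omega\exists n[\zeta(n)\notin D_\alpha]\leftrightarrow\neg\neg\exists n\forall m>n[m\notin D_\alpha]\bigr]$. (ii) $\mathsf{BIM}+\mathsf{MP}_1+\mathbf{AppFT}\vdash\mathbf{AlmFT}$.
   Context: $\mathsf{BIM}$ is the two-sorted intuitionistic theory of natural numbers and functions $\mathbb N\to\mathbb N$ with extensionality, primitive recursive constants, closure of functions under composition, primitive recursion and unbounded search, and full induction. Finite sequences are coded by naturals ($length$, $s\ast\langle n\rangle$, $\overline\gamma n$, $s\sqsubseteq t$ initial part). $D_\alpha=\{n\mid\alpha(n)\ne0\}$. $[\omega]^\omega$: strictly increasing $\zeta:\mathbb N\to\mathbb N$; $[\omega]^m$: codes of strictly increasing sequences of length $m$. $X$ is almost-finite if $\forall\zeta\in[\omega]^\omega\exists n[\zeta(n)\notin X]$. $\mathsf{MP}_1$ (Markov's Principle): $\forall\alpha[\neg\neg\exists n[\alpha(n)\ne0]\rightarrow\exists n[\alpha(n)\ne0]]$. $\mathcal F_\beta=\{\alpha\mid\forall n[\beta(\overline\alpha n)=0]\}$; $\beta$ is a spread-law if $\forall s[\beta(s)=0\leftrightarrow\exists n[\beta(s\ast\langle n\rangle)=0]]$. $Appfan(\beta)$: spread-law and for each $n$ there is $m$ such that every $s\in[\omega]^m$ has some $i<m$ with $\beta(s(i))\ne0$ or $length(s(i))\ne n$. $Almfan(\beta)$: spread-law and $\forall s\forall\zeta\in[\omega]^\omega\exists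 n[\beta(s\ast\langle\zeta(n)\rangle)\ne0]$. $B$ is a thin bar in $\mathcal F_\beta$ if $\forall\gamma\in\mathcal F_\beta\exists n[\overline\gamma n\in B]$ and $s,t\in B$, $s\sqsubseteq t$ imply $s=t$. $\mathbf{AppFT}$: for all $\beta,\alpha$, if $Appfan(\beta)$, $D_\alpha$ is a thin bar in $\mathcal F_\beta$ and $\forall s[s\in D_\alpha\rightarrow\beta(s)=0]$, then $D_\alpha$ is almost-finite. $\mathbf{AlmFT}$: the same with $Almfan(\beta)$ in place of $Appfan(\beta)$. *)

(* Defs.v *)
From Stdlib Require Import List.
Import ListNotations.
Set Implicit Arguments.
Unset Strict Implicit.

(** Unary primitive recursive function constants.  Functions of several
    arguments are unary functions of a pair, [f(m,n)] being [f(J(m,n))];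
    [pRec f g] is the function [h] with [h(m,0) = f(m)] and
    [h(m,S n) = g((m,n),h(m,n))]. *)
Inductive prc : Type :=
| pZ | pI | pS | pK | pL
| pPair (f g : prc)
| pComp (f g : prc)
| pRec (f g : prc).

(** Variables are de Bruijn indices, counted separately for the two sorts:
    a numerical quantifier binds the numerical index 0 and leaves the function
    indices alone, and conversely. *)
Inductive fterm : Type :=
| FVar (n : nat)
| FCst (c : prc).

Inductive nterm : Type :=
| NVar (n : nat)
| NZero
| NPair (t u : nterm)
| NApp (f : fterm) (t : nterm).

Inductive form : Type :=
| Eq0 (t u : nterm)
| Eq1 (f g : fterm)
| Bot
| And (A B : form)
| Or (A B : form)
| Imp (A B : form)
| All0 (A : form)
| Ex0 (A : form)
| All1 (A : form)
| Ex1 (A : form).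

Definition Not (A : form) : form := Imp A Bot.
Definition Iff (A B : form) : form := And (Imp A B) (Imp B A).

Declare Scope bim_scope.
Delimit Scope bim_scope with bim.
Bind Scope bim_scope with nterm fterm form.
Local Open Scope bim_scope.

Notation "# n" := (NVar n) (at level 1, n at level 0, format "# n") : bim_scope.
Notation "$ n" := (FVar n) (at level 1, n at level 0, format "$ n") : bim_scope.
Notation "⟨ t , u ⟩" := (NPair t u) (at level 0, t at level 99, u at level 99) : bim_scope.
Notation "f · t" := (NApp f t) (at level 40, left associativity) : bim_scope.
Notation "t ≈ u" := (Eq0 t u) (at level 70, no associativity) : bim_scope.
Notation "t ≉ u" := (Not (Eq0 t u)) (at level 70, no associativity) : bim_scope.
Notation "f ≡ g" := (Eq1 f g) (at level 70, no associativity) : bim_scope.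
Notation "¬ A" := (Not A) (at level 75, right associativity) : bim_scope.
Notation "A ∧ B" := (And A B) (at level 80, right associativity) : bim_scope.
Notation "A ∨ B" := (Or A B) (at level 85, right associativity) : bim_scope.
Notation "A ⇒ B" := (Imp A B) (at level 90, right associativity) : bim_scope.
Notation "A ⇔ B" := (Iff A B) (at level 95, no associativity) : bim_scope.
Notation "∀₀ A" := (All0 A) (at level 10, A at level 200) : bim_scope.
Notation "∃₀ A" := (Ex0 A) (at level 10, A at level 200) : bim_scope.
Notation "∀₁ A" := (All1 A) (at level 10, A at level 200) : bim_scope.
Notation "∃₁ A" := (Ex1 A) (at level 10, A at level 200) : bim_scope.

Definition Sc (t : nterm) : nterm := FCst pS · t.

Definition scons {X : Type} (x : X) (s : nat -> X) (n : nat) : X :=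
  match n with 0 => x | S m => s m end.

Definition fsub (tau : nat -> fterm) (f : fterm) : fterm :=
  match f with FVar n => tau n | FCst c => FCst c end.

Fixpoint nsub (sigma : nat -> nterm) (tau : nat -> fterm) (t : nterm) : nterm :=
  match t with
  | NVar n => sigma n
  | NZero => NZero
  | NPair t u => NPair (nsub sigma tau t) (nsub sigma tau u)
  | NApp f t => NApp (fsub tau f) (nsub sigma tau t)
  end.

Definition nvS (n : nat) : nterm := NVar (S n).
Definition fvS (n : nat) : fterm := FVar (S n).

Definition nlift0 (t : nterm) : nterm := nsub nvS FVar t.
Definition nlift1 (t : nterm) : nterm := nsub NVar fvS t.
Definition flift1 (f : fterm) : fterm := fsub fvS f.

Fixpoint sub (sigma : nat -> nterm) (tau : nat -> fterm) (A : form) : form :=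
  let up0 := scons (NVar 0) (fun n => nlift0 (sigma n)) in
  let sigma1 := fun n => nlift1 (sigma n) in
  let up1 := scons (FVar 0) (fun n => flift1 (tau n)) in
  match A with
  | Eq0 t u => Eq0 (nsub sigma tau t) (nsub sigma tau u)
  | Eq1 f g => Eq1 (fsub tau f) (fsub tau g)
  | Bot => Bot
  | And A B => And (sub sigma tau A) (sub sigma tau B)
  | Or A B => Or (sub sigma tau A) (sub sigma tau B)
  | Imp A B => Imp (sub sigma tau A) (sub sigma tau B)
  | All0 A => All0 (sub up0 tau A)
  | Ex0 A => Ex0 (sub up0 tau A)
  | All1 A => All1 (sub sigma1 up1 A)
  | Ex1 A => Ex1 (sub sigma1 up1 A)
  end.

Definition lift0 (A : form) : form := sub nvS FVar A.
Definition lift1 (A : form) : form := sub NVar fvS A.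
Definition inst0 (t : nterm) (A : form) : form := sub (scons t NVar) FVar A.
Definition inst1 (f : fterm) (A : form) : form := sub NVar (scons f FVar) A.

Definition theory := form -> Prop.

Definition extend (T : theory) (A : form) : theory := fun B => T B \/ B = A.
Notation "T ⊕ A" := (extend T A) (at level 50, left associativity).

(** The eigenvariable rules do not shift the axioms in [T], so an axiom with
    free variables counts as its universal closure. *)
Inductive prv (T : theory) : list form -> form -> Prop :=
| Ax G A : T A -> prv T G A
| Hyp G A : In A G -> prv T G A
| BotE G A : prv T G Bot -> prv T G A
| AndI G A B : prv T G A -> prv T G B -> prv T G (A ∧ B)
| AndE1 G A B : prv T G (A ∧ B) -> prv T G A
| AndE2 G A B : prv T G (A ∧ B) -> prv T G B
| OrI1 G A B : prv T G A -> prv T G (A ∨ B)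
| OrI2 G A B : prv T G B -> prv T G (A ∨ B)
| OrE G A B C :
    prv T G (A ∨ B) -> prv T (A :: G) C -> prv T (B :: G) C -> prv T G C
| ImpI G A B : prv T (A :: G) B -> prv T G (A ⇒ B)
| ImpE G A B : prv T G (A ⇒ B) -> prv T G A -> prv T G B
| All0I G A : prv T (map lift0 G) A -> prv T G (∀₀ A)
| All0E G A t : prv T G (∀₀ A) -> prv T G (inst0 t A)
| Ex0I G A t : prv T G (inst0 t A) -> prv T G (∃₀ A)
| Ex0E G A C :
    prv T G (∃₀ A) -> prv T (A :: map lift0 G) (lift0 C) -> prv T G C
| All1I G A : prv T (map lift1 G) A -> prv T G (∀₁ A)
| All1E G A f : prv T G (∀₁ A) -> prv T G (inst1 f A)
| Ex1I G A f : prv T G (inst1 f A) -> prv T G (∃₁ A)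
| Ex1E G A C :
    prv T G (∃₁ A) -> prv T (A :: map lift1 G) (lift1 C) -> prv T G C
| Eq0I G t : prv T G (t ≈ t)
| Eq0E G A t u : prv T G (t ≈ u) -> prv T G (inst0 t A) -> prv T G (inst0 u A)
| Eq1I G f : prv T G (f ≡ f)
| Eq1E G A f g : prv T G (f ≡ g) -> prv T G (inst1 f A) -> prv T G (inst1 g A).

Notation "T ⊢ A" := (prv T nil A) (at level 99, no associativity).

Definition pAdd : prc := pRec pI (pComp pS pL).
Definition pPred : prc := pComp (pRec pZ (pComp pL pK)) (pPair pZ pI).
Definition pSub : prc := pRec pI (pComp pPred pL).
Definition pSg : prc := pComp (pRec pZ (pComp pS pZ)) (pPair pZ pI).

(** Coding: the empty sequence is [0] and [s * <n>] is [S (J(s,n))], so every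
    number codes exactly one finite sequence.  [pDrop(s,n)] removes the last
    [n] entries of [s]; [length(s)] is the number of [n < s] for which
    [pDrop(s,n)] is not empty (a code is at least as large as its length).
    [s(i)] is only meaningful for [i < length(s)]. *)
Definition pInit : prc := pComp pK pPred.
Definition pDrop : prc := pRec pI (pComp pInit pL).
Definition pLen : prc :=
  pComp (pRec pZ (pComp pAdd (pPair pL (pComp pSg (pComp pDrop pK)))))
        (pPair pI pI).
Definition pNth : prc :=
  pComp (pComp pL pPred)
        (pComp pDrop
               (pPair pK (pComp pSub (pPair (pComp pLen pK) (pComp pS pL))))).

Definition snoc (s n : nterm) : nterm := Sc ⟨s, n⟩.
Definition len (s : nterm) : nterm := FCst pLen · s.
Definition nth (s i : nterm) : nterm := FCst pNth · ⟨s, i⟩.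

Definition Lt (t u : nterm) : form :=
  ∃₀ Sc (FCst pAdd · ⟨nlift0 t, #0⟩) ≈ nlift0 u.
Definition Le (t u : nterm) : form := Lt t (Sc u).

Inductive BIM : theory :=
| ax_ext : BIM (∀₁ ∀₁ ($1 ≡ $0 ⇔ ∀₀ $1 · #0 ≈ $0 · #0))
| ax_zero : BIM (∀₀ FCst pZ · #0 ≈ NZero)
| ax_id : BIM (∀₀ FCst pI · #0 ≈ #0)
| ax_S_neq0 : BIM (∀₀ Sc #0 ≉ NZero)
| ax_S_inj : BIM (∀₀ ∀₀ (Sc #1 ≈ Sc #0 ⇒ #1 ≈ #0))
(** Three recursion equations determining [J] as the Cantor pairing function
    [J(m,n) = (m+n)(m+n+1)/2 + m]; [K] and [L] are its projections. *)
| ax_J00 : BIM (⟨NZero, NZero⟩ ≈ NZero)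
| ax_J0S : BIM (∀₀ ⟨NZero, Sc #0⟩ ≈ Sc ⟨#0, NZero⟩)
| ax_JS : BIM (∀₀ ∀₀ ⟨Sc #1, #0⟩ ≈ Sc ⟨#1, Sc #0⟩)
| ax_K : BIM (∀₀ ∀₀ FCst pK · ⟨#1, #0⟩ ≈ #1)
| ax_L : BIM (∀₀ ∀₀ FCst pL · ⟨#1, #0⟩ ≈ #0)
| ax_J_surj : BIM (∀₀ ⟨FCst pK · #0, FCst pL · #0⟩ ≈ #0)
| ax_cst_pair f g :
    BIM (∀₀ FCst (pPair f g) · #0 ≈ ⟨FCst f · #0, FCst g · #0⟩)
| ax_cst_comp f g :
    BIM (∀₀ FCst (pComp f g) · #0 ≈ FCst f · (FCst g · #0))
| ax_cst_rec0 f g :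
    BIM (∀₀ FCst (pRec f g) · ⟨#0, NZero⟩ ≈ FCst f · #0)
| ax_cst_recS f g :
    BIM (∀₀ ∀₀ FCst (pRec f g) · ⟨#1, Sc #0⟩
               ≈ FCst g · ⟨⟨#1, #0⟩, FCst (pRec f g) · ⟨#1, #0⟩⟩)
| ax_comp : BIM (∀₁ ∀₁ ∃₁ ∀₀ $0 · #0 ≈ $2 · ($1 · #0))
| ax_pair : BIM (∀₁ ∀₁ ∃₁ ∀₀ $0 · #0 ≈ ⟨$2 · #0, $1 · #0⟩)
| ax_rec :
    BIM (∀₁ ∀₁ ∃₁ ∀₀ ($0 · ⟨#0, NZero⟩ ≈ $2 · #0
                      ∧ ∀₀ $0 · ⟨#1, Sc #0⟩ ≈ $1 · ⟨⟨#1, #0⟩, $0 · ⟨#1, #0⟩⟩))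
| ax_search :
    BIM (∀₁ ((∀₀ ∃₀ $0 · ⟨#1, #0⟩ ≈ NZero)
             ⇒ ∃₁ ∀₀ ($1 · ⟨#0, $0 · #0⟩ ≈ NZero
                      ∧ ∀₀ (Lt #0 ($0 · #1) ⇒ $1 · ⟨#1, #0⟩ ≉ NZero))))
(** Induction; every free variable of [A] other than [#0] is a parameter. *)
| ax_ind A :
    BIM (inst0 NZero A ∧ (∀₀ (A ⇒ sub (scons (Sc #0) nvS) FVar A)) ⇒ ∀₀ A).

(** Below, [a], [b], [g], [z] stand for the function terms [α], [β], [γ], [ζ],
    and [InD a t] for [t ∈ D_α]. *)

Definition InD (a : fterm) (t : nterm) : form := a · t ≉ NZero.

Definition Incr (z : fterm) : form := ∀₀ Lt (z · #0) (z · Sc #0).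

(** [s ∈ [ω]^m]. *)
Definition IncrSeq (m s : nterm) : form :=
  len s ≈ m
  ∧ ∀₀ (Lt (Sc #0) (nlift0 m)
        ⇒ Lt (nth (nlift0 s) #0) (nth (nlift0 s) (Sc #0))).

Definition AlmostFinite (a : fterm) : form :=
  ∀₁ (Incr $0 ⇒ ∃₀ ¬ InD (flift1 a) ($0 · #0)).

(** The graph [s = γ̄ n] of the course-of-values functional; a property of
    [γ̄ n] is stated as [∃s(s = γ̄ n ∧ ..)]. *)
Definition Restr (g : fterm) (n s : nterm) : form :=
  len s ≈ n ∧ ∀₀ (Lt #0 (nlift0 n) ⇒ nth (nlift0 s) #0 ≈ g · #0).

Definition Prefix (s t : nterm) : form :=
  Le (len s) (len t)
  ∧ ∀₀ (Lt #0 (nlift0 (len s)) ⇒ nth (nlift0 s) #0 ≈ nth (nlift0 t) #0).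

Definition InF (b g : fterm) : form :=
  ∀₀ ∃₀ (Restr g #1 #0 ∧ b · #0 ≈ NZero).

Definition SpreadLaw (b : fterm) : form :=
  ∀₀ (b · #0 ≈ NZero ⇔ ∃₀ b · snoc #1 #0 ≈ NZero).

(** Bound numerical variables, outermost first: [n], [m], [s], [i]. *)
Definition Appfan (b : fterm) : form :=
  SpreadLaw b
  ∧ ∀₀ ∃₀ ∀₀ (IncrSeq #1 #0
              ⇒ ∃₀ (Lt #0 #2 ∧ (b · nth #1 #0 ≉ NZero ∨ len (nth #1 #0) ≉ #3))).

(** Bound variables, outermost first: [s], [ζ], [n]. *)
Definition Almfan (b : fterm) : form :=
  SpreadLaw b
  ∧ ∀₀ ∀₁ (Incr $0 ⇒ ∃₀ flift1 b · snoc #1 ($0 · #0) ≉ NZero).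

Definition ThinBar (b a : fterm) : form :=
  (∀₁ (InF (flift1 b) $0 ⇒ ∃₀ ∃₀ (Restr $0 #1 #0 ∧ InD (flift1 a) #0)))
  ∧ ∀₀ ∀₀ (InD a #1 ∧ InD a #0 ∧ Prefix #1 #0 ⇒ #1 ≈ #0).

Definition FanTheorem (Fan : fterm -> form) : form :=
  ∀₁ ∀₁ (Fan $1 ∧ ThinBar $1 $0 ∧ (∀₀ (InD $0 #0 ⇒ $1 · #0 ≈ NZero))
         ⇒ AlmostFinite $0).

Definition AppFT : form := FanTheorem Appfan.
Definition AlmFT : form := FanTheorem Almfan.

Definition MP1 : form :=
  ∀₁ (¬ ¬ (∃₀ $0 · #0 ≉ NZero) ⇒ ∃₀ $0 · #0 ≉ NZero).

(** [¬¬∃n∀m>n[m ∉ D_α]]. *)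
Definition NotNotFinite (a : fterm) : form :=
  ¬ ¬ ∃₀ ∀₀ (Lt #1 #0 ⇒ ¬ InD a #0).

(* Main.v *)
(** Formulas are interpreted as sheaves over the finite contexts, for which forcing
    coincides with derivability; reasoning in the theory then takes place in this
    sheaf model.

    For (ii), Markov's Principle reduces the claim to refuting that a thin bar [D]
    of an almost-fan is unbounded.  Replace the almost-fan by its left-child
    right-sibling tree: a path moves from a node to its first child or to its next
    sibling.  Every node has at most two successors, so level [n] has at most [2^n]
    nodes and the new tree is an approximate fan.  In an almost-fan no node has
    infinitely many right siblings, so an infinite branch of the new tree goes to a
    child infinitely often and determines a member of the almost-fan.  Hence the
    paths that have just moved from a node of [D] to a child form a thin bar; it is
    unbounded because [D] is, contradicting [AppFT]. *)

(* An approximate fan has to come with a number that bounds each level, whereas an almost-fan only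
   says that no increasing sequence stays among the successors of a node. The binary tree trades
   branching for depth: the bound on its levels is automatic, but its branches may linger among
   siblings, and it is there, in showing that they do not linger forever, that the almost-fan
   condition is spent.

   The object theory constrains how all this is argued. It has no comprehension and no choice, so
   each function has to come from an explicit term ([fun_ex]), from primitive recursion ([rec_ex],
   [seqrec_ex]) or from search through a decidable relation ([search_ex]); hence the many
   characteristic functions built from [minus], [dist] and [ite]. Its induction is a scheme, so each
   internal induction displays its formula in de Bruijn form. Finally, a forced existential or
   disjunction holds only locally: it can be opened only while another forced statement is being
   proved. *)
From Stdlib Require Import List Lia Setoid Morphisms.
Require Import Defs.
Import ListNotations.
Set Implicit Arguments.
Unset Strict Implicit.
Local Open Scope bim_scope.

(** * Substitution *)

Lemma fsub_agree (tau tau' : nat -> fterm) f :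
  (forall n, tau n = tau' n) -> fsub tau f = fsub tau' f.
Proof. intros H; destruct f; simpl; auto. Qed.

Lemma nsub_agree sigma sigma' tau tau' t :
  (forall n, sigma n = sigma' n) -> (forall n, tau n = tau' n) ->
  nsub sigma tau t = nsub sigma' tau' t.
Proof.
  intros H K; induction t; simpl; f_equal; auto using fsub_agree.
Qed.

(** [up0] and [up1] are the substitutions that [sub] forms under a binder, named so that they can be
    folded. *)
Definition up0 (sigma : nat -> nterm) : nat -> nterm :=
  scons (NVar 0) (fun n => nlift0 (sigma n)).
Definition up1 (tau : nat -> fterm) : nat -> fterm :=
  scons (FVar 0) (fun n => flift1 (tau n)).

Lemma sub_agree sigma sigma' tau tau' A :
  (forall n, sigma n = sigma' n) -> (forall n, tau n = tau' n) ->
  sub sigma tau A = sub sigma' tau' A.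
Proof.
  revert sigma sigma' tau tau'.
  induction A; intros p p' q q' H K; simpl; f_equal; auto using nsub_agree, fsub_agree.
  1, 2: apply IHA; auto; intros [|n]; simpl; congruence.
  1, 2: apply IHA; [intros n; now rewrite H|intros [|n]; simpl; congruence].
Qed.

Lemma fsub_comp tau tau' f :
  fsub tau' (fsub tau f) = fsub (fun n => fsub tau' (tau n)) f.
Proof. now destruct f. Qed.

Lemma nsub_comp sigma tau sigma' tau' t :
  nsub sigma' tau' (nsub sigma tau t)
  = nsub (fun n => nsub sigma' tau' (sigma n)) (fun n => fsub tau' (tau n)) t.
Proof. induction t; simpl; f_equal; auto using fsub_comp. Qed.

Lemma fsub_id f : fsub FVar f = f.
Proof. now destruct f. Qed.

Lemma nsub_id t : nsub NVar FVar t = t.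
Proof. induction t; simpl; f_equal; auto using fsub_id. Qed.

Lemma sub_comp sigma tau sigma' tau' A :
  sub sigma' tau' (sub sigma tau A)
  = sub (fun n => nsub sigma' tau' (sigma n)) (fun n => fsub tau' (tau n)) A.
Proof.
  revert sigma tau sigma' tau'.
  induction A; intros p q p' q'; simpl; f_equal; auto using nsub_comp, fsub_comp.
  1, 2: rewrite IHA; apply sub_agree; auto; intros [|n]; simpl; auto;
    unfold nlift0; rewrite !nsub_comp; apply nsub_agree; intros; simpl;
    rewrite ?fsub_id; auto.
  1, 2: rewrite IHA; apply sub_agree;
    [ intros n; unfold nlift1; rewrite !nsub_comp; apply nsub_agree; auto;
      intros m; simpl; now destruct (q' m)
    | intros [|n]; simpl; auto; unfold flift1; rewrite !fsub_comp;
      apply fsub_agree; auto ].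
Qed.

Lemma sub_id A : sub NVar FVar A = A.
Proof.
  induction A; simpl; f_equal; auto using nsub_id, fsub_id;
    rewrite <- IHA at 2; apply sub_agree; auto; now intros [|n].
Qed.

Lemma sub_inst0 sigma tau t A :
  sub sigma tau (inst0 t A) = inst0 (nsub sigma tau t) (sub (up0 sigma) tau A).
Proof.
  unfold inst0; rewrite !sub_comp; apply sub_agree; intros n.
  - destruct n; simpl; auto. unfold nlift0; rewrite nsub_comp; simpl.
    symmetry; apply nsub_id.
  - symmetry; apply fsub_id.
Qed.

Lemma sub_inst1 sigma tau f A :
  sub sigma tau (inst1 f A)
  = inst1 (fsub tau f) (sub (fun n => nlift1 (sigma n)) (up1 tau) A).
Proof.
  unfold inst1; rewrite !sub_comp; apply sub_agree; intros n.
  - simpl; unfold nlift1; rewrite nsub_comp; simpl; symmetry; apply nsub_id.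
  - destruct n; simpl; auto. unfold flift1; rewrite fsub_comp; simpl.
    symmetry; apply fsub_id.
Qed.

Lemma sub_lift0 sigma tau A :
  sub (up0 sigma) tau (lift0 A) = lift0 (sub sigma tau A).
Proof.
  unfold lift0; rewrite !sub_comp; apply sub_agree; intros n; simpl; auto.
  symmetry; apply fsub_id.
Qed.

Lemma sub_lift1 sigma tau A :
  sub (fun n => nlift1 (sigma n)) (up1 tau) (lift1 A) = lift1 (sub sigma tau A).
Proof.
  unfold lift1; rewrite !sub_comp; apply sub_agree; intros n; simpl; auto.
Qed.

Lemma inst0_up sigma tau t A :
  inst0 t (sub (up0 sigma) tau A) = sub (scons t sigma) tau A.
Proof.
  unfold inst0; rewrite sub_comp; apply sub_agree; intros n.
  - destruct n; simpl; auto. unfold nlift0; rewrite nsub_comp; apply nsub_id.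
  - apply fsub_id.
Qed.

Lemma inst1_up sigma tau f A :
  inst1 f (sub (fun n => nlift1 (sigma n)) (up1 tau) A) = sub sigma (scons f tau) A.
Proof.
  unfold inst1; rewrite sub_comp; apply sub_agree; intros n.
  - simpl; unfold nlift1; rewrite nsub_comp; apply nsub_id.
  - destruct n; simpl; auto. unfold flift1; rewrite fsub_comp; apply fsub_id.
Qed.

(** * Free variables and fresh variables *)

Fixpoint bound0t (t : nterm) : nat :=
  match t with
  | NVar n => S n
  | NZero => 0
  | NPair t u => max (bound0t t) (bound0t u)
  | NApp f t => bound0t t
  end.

Definition bound1f (f : fterm) : nat :=
  match f with FVar n => S n | FCst _ => 0 end.

Fixpoint bound1t (t : nterm) : nat :=
  match t with
  | NVar _ | NZero => 0
  | NPair t u => max (bound1t t) (bound1t u)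
  | NApp f t => max (bound1f f) (bound1t t)
  end.

Fixpoint bound0 (A : form) : nat :=
  match A with
  | Eq0 t u => max (bound0t t) (bound0t u)
  | Eq1 _ _ | Bot => 0
  | And A B | Or A B | Imp A B => max (bound0 A) (bound0 B)
  | All0 A | Ex0 A => pred (bound0 A)
  | All1 A | Ex1 A => bound0 A
  end.

Fixpoint bound1 (A : form) : nat :=
  match A with
  | Eq0 t u => max (bound1t t) (bound1t u)
  | Eq1 f g => max (bound1f f) (bound1f g)
  | Bot => 0
  | And A B | Or A B | Imp A B => max (bound1 A) (bound1 B)
  | All0 A | Ex0 A => bound1 A
  | All1 A | Ex1 A => pred (bound1 A)
  end.

Lemma fsub_below tau tau' f :
  (forall n, n < bound1f f -> tau n = tau' n) -> fsub tau f = fsub tau' f.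
Proof. destruct f; simpl; auto. Qed.

Lemma nsub_below sigma sigma' tau tau' t :
  (forall n, n < bound0t t -> sigma n = sigma' n) ->
  (forall n, n < bound1t t -> tau n = tau' n) ->
  nsub sigma tau t = nsub sigma' tau' t.
Proof.
  intros H K; induction t; simpl in *; f_equal; auto.
  - apply IHt1; intros; [apply H|apply K]; lia.
  - apply IHt2; intros; [apply H|apply K]; lia.
  - apply fsub_below; intros; apply K; lia.
  - apply IHt; intros; [apply H|apply K]; lia.
Qed.

Lemma sub_below sigma sigma' tau tau' A :
  (forall n, n < bound0 A -> sigma n = sigma' n) ->
  (forall n, n < bound1 A -> tau n = tau' n) ->
  sub sigma tau A = sub sigma' tau' A.
Proof.
  revert sigma sigma' tau tau'.
  induction A; intros p p' q q' H K; simpl in *; f_equal;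
    try (apply nsub_below; intros; [apply H|apply K]; lia);
    try (apply fsub_below; intros; apply K; lia);
    try (apply IHA1; intros; [apply H|apply K]; lia);
    try (apply IHA2; intros; [apply H|apply K]; lia); auto.
  1, 2: apply IHA; auto; intros [|n] L; simpl; auto; rewrite H; auto; lia.
  1, 2: apply IHA; [intros n L; now rewrite H|intros [|n] L; simpl; auto];
    rewrite K; auto; lia.
Qed.

Lemma fresh0 (l : list form) : exists k, forall A, In A l -> bound0 A <= k.
Proof.
  induction l as [|A l [k IH]].
  - exists 0; intros A [].
  - exists (max (bound0 A) k); intros B [->|H]; [lia|].
    specialize (IH _ H); lia.
Qed.

Lemma fresh1 (l : list form) : exists k, forall A, In A l -> bound1 A <= k.
Proof.
  induction l as [|A l [k IH]].
  - exists 0; intros A [].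
  - exists (max (bound1 A) k); intros B [->|H]; [lia|].
    specialize (IH _ H); lia.
Qed.

(** * Structural rules *)

(** Closure under substitution is what lets derivations be substituted, since a substitution
    instance of an axiom has to be derivable again. *)
Class BIMTheory (T : theory) : Prop := {
  bim_ax : forall A, BIM A -> T A;
  sub_closed : forall sigma tau A, T A -> T (sub sigma tau A) }.

(** Only induction has parameters; its substitution instance is induction for the formula
    substituted under the binder. The other axioms are closed. *)
Lemma BIM_sub_closed sigma tau A : BIM A -> BIM (sub sigma tau A).
Proof.
  destruct 1; try (simpl; constructor).
  match goal with |- BIM ?X => enough (X = (inst0 NZero (sub (up0 sigma) tau A)
     ∧ (∀₀ (sub (up0 sigma) tau A
            ⇒ sub (scons (Sc #0) nvS) FVar (sub (up0 sigma) tau A)))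
     ⇒ ∀₀ (sub (up0 sigma) tau A))) as -> by constructor end.
  cbn [sub]. rewrite sub_inst0. do 3 f_equal.
  fold (up0 sigma). f_equal.
  rewrite !sub_comp. apply sub_agree.
  - intros [|n]; simpl; auto. unfold nlift0; rewrite !nsub_comp.
    apply nsub_agree; auto.
  - intros n; simpl. symmetry; apply fsub_id.
Qed.

Section Structural.
Context {T : theory} {HT : BIMTheory T}.

Lemma prv_weaken G G' A : incl G G' -> prv T G A -> prv T G' A.
Proof.
  intros L D; revert G' L; induction D; intros G' L;
    try solve [econstructor; eauto].
  - eapply OrE; [eauto|apply IHD2|apply IHD3]; intros x [->|I]; simpl; auto.
  - apply ImpI, IHD; intros x [->|I]; simpl; auto.
  - apply All0I, IHD, incl_map, L.
  - eapply Ex0E; [eauto|apply IHD2]. intros x [->|I]; simpl; auto.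
    right; revert I; apply incl_map, L.
  - apply All1I, IHD, incl_map, L.
  - eapply Ex1E; [eauto|apply IHD2]. intros x [->|I]; simpl; auto.
    right; revert I; apply incl_map, L.
Qed.

Lemma prv_sub G A :
  prv T G A -> forall sigma tau, prv T (map (sub sigma tau) G) (sub sigma tau A).
Proof.
  induction 1; intros sigma tau; cbn [sub map] in *;
    fold (up0 sigma) in *; fold (up1 tau) in *;
    rewrite ?sub_inst0, ?sub_inst1 in *.
  - apply Ax, sub_closed, H.
  - apply Hyp, in_map, H.
  - apply BotE; eauto.
  - apply AndI; eauto.
  - eapply AndE1, IHprv.
  - eapply AndE2, IHprv.
  - apply OrI1; eauto.
  - apply OrI2; eauto.
  - eapply OrE; [apply IHprv1|apply IHprv2|apply IHprv3].
  - apply ImpI, IHprv.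
  - eapply ImpE; [apply IHprv1|apply IHprv2].
  - apply All0I. specialize (IHprv (up0 sigma) tau).
    rewrite map_map in *.
    erewrite map_ext; [exact IHprv|]. intros; symmetry; apply sub_lift0.
  - apply All0E, IHprv.
  - eapply Ex0I. rewrite <- sub_inst0. apply IHprv.
  - eapply Ex0E; [apply IHprv1|]. specialize (IHprv2 (up0 sigma) tau).
    rewrite sub_lift0 in IHprv2. rewrite map_map in *.
    erewrite map_ext; [exact IHprv2|]. intros; symmetry; apply sub_lift0.
  - apply All1I. specialize (IHprv (fun n => nlift1 (sigma n)) (up1 tau)).
    rewrite map_map in *.
    erewrite map_ext; [exact IHprv|]. intros; symmetry; apply sub_lift1.
  - apply All1E, IHprv.
  - eapply Ex1I. rewrite <- sub_inst1. apply IHprv.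
  - eapply Ex1E; [apply IHprv1|].
    specialize (IHprv2 (fun n => nlift1 (sigma n)) (up1 tau)).
    rewrite sub_lift1 in IHprv2. rewrite map_map in *.
    erewrite map_ext; [exact IHprv2|]. intros; symmetry; apply sub_lift1.
  - apply Eq0I.
  - eapply Eq0E; [apply IHprv1|]. rewrite <- sub_inst0; apply IHprv2.
  - apply Eq1I.
  - eapply Eq1E; [apply IHprv1|]. rewrite <- sub_inst1; apply IHprv2.
Qed.

(** Moves the fresh variable [k] to index 0 and shifts the others, which turns an instance at [k]
    back into the body of the quantifier and acts as a lift on formulas without [k]. *)
Definition rename0 (k n : nat) : nterm := if Nat.eqb n k then #0 else nvS n.
Definition rename1 (k n : nat) : fterm := if Nat.eqb n k then $0 else fvS n.

Lemma rename0_lift k A : bound0 A <= k -> sub (rename0 k) FVar A = lift0 A.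
Proof.
  intros H; apply sub_below; auto; intros n L; unfold rename0.
  destruct (PeanoNat.Nat.eqb_spec n k); [lia|auto].
Qed.

Lemma rename1_lift k A : bound1 A <= k -> sub NVar (rename1 k) A = lift1 A.
Proof.
  intros H; apply sub_below; auto; intros n L; unfold rename1.
  destruct (PeanoNat.Nat.eqb_spec n k); [lia|auto].
Qed.

Lemma rename0_inst k B :
  bound0 (∀₀ B) <= k -> sub (rename0 k) FVar (inst0 (NVar k) B) = B.
Proof.
  intros H. unfold inst0; rewrite sub_comp. rewrite <- sub_id.
  apply sub_below; auto. intros [|n] L; simpl in *; unfold rename0.
  - now rewrite PeanoNat.Nat.eqb_refl.
  - destruct (PeanoNat.Nat.eqb_spec n k); [lia|auto].
Qed.

Lemma rename1_inst k B :
  bound1 (∀₁ B) <= k -> sub NVar (rename1 k) (inst1 (FVar k) B) = B.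
Proof.
  intros H. unfold inst1; rewrite sub_comp. rewrite <- sub_id.
  apply sub_below; auto. intros [|n] L; simpl in *; unfold rename1.
  - now rewrite PeanoNat.Nat.eqb_refl.
  - destruct (PeanoNat.Nat.eqb_spec n k); [lia|auto].
Qed.

Lemma map_rename0 k G :
  (forall A, In A G -> bound0 A <= k) -> map (sub (rename0 k) FVar) G = map lift0 G.
Proof. intros H; apply map_ext_in; intros; apply rename0_lift; auto. Qed.

Lemma map_rename1 k G :
  (forall A, In A G -> bound1 A <= k) -> map (sub NVar (rename1 k)) G = map lift1 G.
Proof. intros H; apply map_ext_in; intros; apply rename1_lift; auto. Qed.

(** The premise is used at one fresh variable only; renaming that variable yields the premise of the
    eigenvariable rule. In this form the quantifier rules match quantification over terms in
    Rocq. *)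
Lemma All0I_inst G B : (forall t, prv T G (inst0 t B)) -> prv T G (∀₀ B).
Proof.
  intros H. destruct (fresh0 ((∀₀ B) :: G)) as [k F].
  apply All0I. rewrite <- map_rename0 with (k := k) by (intros; apply F; simpl; auto).
  rewrite <- (@rename0_inst k B) by (apply F; simpl; auto).
  apply prv_sub, H.
Qed.

Lemma All1I_inst G B : (forall f, prv T G (inst1 f B)) -> prv T G (∀₁ B).
Proof.
  intros H. destruct (fresh1 ((∀₁ B) :: G)) as [k F].
  apply All1I. rewrite <- map_rename1 with (k := k) by (intros; apply F; simpl; auto).
  rewrite <- (@rename1_inst k B) by (apply F; simpl; auto).
  apply prv_sub, H.
Qed.

Lemma Ex0E_inst G B C :
  prv T G (∃₀ B) -> (forall t, prv T (inst0 t B :: G) C) -> prv T G C.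
Proof.
  intros H K. destruct (fresh0 ((∃₀ B) :: C :: G)) as [k F].
  eapply Ex0E; [exact H|].
  rewrite <- map_rename0 with (k := k) by (intros; apply F; simpl; auto).
  rewrite <- (@rename0_inst k B) at 1 by (apply (F (Ex0 B)); simpl; auto).
  rewrite <- (@rename0_lift k C) by (apply F; simpl; auto).
  apply (prv_sub (K (NVar k))).
Qed.

Lemma Ex1E_inst G B C :
  prv T G (∃₁ B) -> (forall f, prv T (inst1 f B :: G) C) -> prv T G C.
Proof.
  intros H K. destruct (fresh1 ((∃₁ B) :: C :: G)) as [k F].
  eapply Ex1E; [exact H|].
  rewrite <- map_rename1 with (k := k) by (intros; apply F; simpl; auto).
  rewrite <- (@rename1_inst k B) at 1 by (apply (F (Ex1 B)); simpl; auto).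
  rewrite <- (@rename1_lift k C) by (apply F; simpl; auto).
  apply (prv_sub (K (FVar k))).
Qed.
End Structural.

(** * Forcing *)

(** A sheaf over the contexts, ordered by inclusion, where the formulas [C] test
    for coverings.  Formulas become such sheaves with the quantifiers ranging over
    terms, so that a derivation in [T] is written as a Rocq proof. *)
Record Om (T : theory) := {
  holds : list form -> Prop;
  mono : forall G G', incl G G' -> holds G -> holds G';
  glue : forall G,
    (forall C G', incl G G' ->
       (forall G'', incl G' G'' -> holds G'' -> prv T G'' C) -> prv T G' C) ->
    holds G }.

Definition frc {T} (G : list form) (P : Om T) : Prop := holds P G.

Section Forcing.
Context {T : theory}.

Lemma frc_mono G G' (P : Om T) : incl G G' -> frc G P -> frc G' P.
Proof. apply mono. Qed.

Program Definition oprv (A : form) : Om T := {| holds := fun G => prv T G A |}.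
Next Obligation. eauto using prv_weaken. Qed.
Next Obligation. apply H; auto using incl_refl. Qed.

Program Definition oand (P Q : Om T) : Om T :=
  {| holds := fun G => frc G P /\ frc G Q |}.
Next Obligation. eauto using frc_mono. Qed.
Next Obligation.
  split; apply glue; intros C G' L K; apply H; auto; intros G'' L' []; auto.
Qed.

Program Definition oimp (P Q : Om T) : Om T :=
  {| holds := fun G => forall G', incl G G' -> frc G' P -> frc G' Q |}.
Next Obligation. apply H0; auto. eapply incl_tran; eauto. Qed.
Next Obligation.
  apply glue; intros C G1 L1 K. apply H; [eapply incl_tran; eauto|].
  intros G2 L2 H2; apply K; auto. apply H2; [apply incl_refl|].
  eapply frc_mono; [|eassumption]. eapply incl_tran; eauto.
Qed.

Program Definition oall {X : Type} (P : X -> Om T) : Om T :=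
  {| holds := fun G => forall x, frc G (P x) |}.
Next Obligation. eauto using frc_mono. Qed.
Next Obligation.
  apply glue; intros C G1 L1 K. apply H; auto. intros G2 L2 H2; apply K; auto. apply H2.
Qed.

(** A pointwise existential would not satisfy [glue]. This is its sheafification: the elimination
    rule into test formulas, taken as the definition. *)
Program Definition oex {X : Type} (P : X -> Om T) : Om T :=
  {| holds := fun G => forall C G', incl G G' ->
       (forall x G'', incl G' G'' -> frc G'' (P x) -> prv T G'' C) -> prv T G' C |}.
Next Obligation. apply H0; auto. eapply incl_tran; eauto. Qed.
Next Obligation.
  apply H; auto. intros G2 L2 H2. apply H2; [apply incl_refl|].
  intros x G3 L3. apply H1. eapply incl_tran; eauto.
Qed.

Definition oor (P Q : Om T) : Om T := oex (fun b : bool => if b then P else Q).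
Definition obot : Om T := oprv Bot.
Definition oeq (t u : nterm) : Om T := oprv (t ≈ u).
Definition onot (P : Om T) : Om T := oimp P obot.
Definition oiff (P Q : Om T) : Om T := oand (oimp P Q) (oimp Q P).

Lemma imp_E G P Q : frc G (oimp P Q) -> frc G P -> frc G Q.
Proof. intros H; apply H, incl_refl. Qed.

Lemma iff1 G P Q : frc G (oiff P Q) -> frc G P -> frc G Q.
Proof. intros [H _]; apply H, incl_refl. Qed.

Lemma iff2 G P Q : frc G (oiff P Q) -> frc G Q -> frc G P.
Proof. intros [_ H]; apply H, incl_refl. Qed.

Lemma ex_I X G (P : X -> Om T) x : frc G (P x) -> frc G (oex P).
Proof.
  intros H C G' L K. apply (K x); [apply incl_refl|]. eapply frc_mono; eauto.
Qed.

(** The definition eliminates into formulas only; [glue] extends this to every sheaf. *)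
Lemma ex_E X G (P : X -> Om T) (Q : Om T) :
  frc G (oex P) -> (forall x G', incl G G' -> frc G' (P x) -> frc G' Q) -> frc G Q.
Proof.
  intros H K. apply glue; intros C G' L M. apply H; auto.
  intros x G2 L2 Hx. apply M; auto. apply (K x); auto. eapply incl_tran; eauto.
Qed.

Lemma or_I1 G P Q : frc G P -> frc G (oor P Q).
Proof. intros H; apply (@ex_I bool G _ true), H. Qed.

Lemma or_I2 G P Q : frc G Q -> frc G (oor P Q).
Proof. intros H; apply (@ex_I bool G _ false), H. Qed.

Lemma or_E G P Q (R : Om T) :
  frc G (oor P Q) -> (forall G', incl G G' -> frc G' P -> frc G' R) ->
  (forall G', incl G G' -> frc G' Q -> frc G' R) -> frc G R.
Proof. intros H K K'; apply (ex_E H); intros [|]; auto. Qed.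

Lemma bot_E G (P : Om T) : frc G obot -> frc G P.
Proof.
  intros H; apply glue; intros C G' L _. apply BotE.
  exact (@prv_weaken T G G' Bot L H).
Qed.

Fixpoint ev (sigma : nat -> nterm) (tau : nat -> fterm) (A : form) : Om T :=
  match A with
  | Eq0 t u => oeq (nsub sigma tau t) (nsub sigma tau u)
  | Eq1 f g => oprv (fsub tau f ≡ fsub tau g)
  | Bot => obot
  | And A B => oand (ev sigma tau A) (ev sigma tau B)
  | Or A B => oor (ev sigma tau A) (ev sigma tau B)
  | Imp A B => oimp (ev sigma tau A) (ev sigma tau B)
  | All0 A => oall (fun t => ev (scons t sigma) tau A)
  | Ex0 A => oex (fun t => ev (scons t sigma) tau A)
  | All1 A => oall (fun f => ev sigma (scons f tau) A)
  | Ex1 A => oex (fun f => ev sigma (scons f tau) A)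
  end.

Context {HT : BIMTheory T}.

(** For disjunctions and existentials, the forward direction tests the covering with the formula
    itself, and the converse is the elimination rule. For implications, the forward direction passes
    to the context extended by the antecedent. *)
Theorem ev_prv A : forall sigma tau G,
  frc G (ev sigma tau A) <-> prv T G (sub sigma tau A).
Proof.
  induction A; intros p q G; cbn [ev sub]; fold (up0 p); fold (up1 q); try reflexivity.
  - change (frc G (ev p q A1) /\ frc G (ev p q A2)
      <-> prv T G (sub p q A1 ∧ sub p q A2)).
    rewrite IHA1, IHA2. split.
    + intros []; now apply AndI.
    + intros H; split; [eapply AndE1, H|eapply AndE2, H].
  - split.
    + intros H. apply H; [apply incl_refl|]. intros [|] G' L K.
      * apply OrI1, IHA1, K.
      * apply OrI2, IHA2, K.
    + intros H C G' L K. eapply OrE; [eapply prv_weaken; eauto| |];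
        [apply (K true)|apply (K false)]; auto using incl_tl, incl_refl.
      * apply IHA1, Hyp; simpl; auto.
      * apply IHA2, Hyp; simpl; auto.
  - split.
    + intros H. apply ImpI, IHA2, H; auto using incl_tl, incl_refl.
      apply IHA1, Hyp; simpl; auto.
    + intros H G' L K. apply IHA2. eapply ImpE; [eapply prv_weaken; eauto|].
      now apply IHA1.
  - split.
    + intros H. apply All0I_inst. intros t. rewrite inst0_up. apply IHA, H.
    + intros H t. apply IHA. rewrite <- inst0_up. apply All0E, H.
  - split.
    + intros H. apply H; [apply incl_refl|]. intros t G' L K.
      apply Ex0I with t. rewrite inst0_up. apply IHA, K.
    + intros H C G' L K. eapply Ex0E_inst; [eapply prv_weaken; eauto|].
      intros t. apply (K t); auto using incl_tl, incl_refl.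
      apply IHA. rewrite <- inst0_up. apply Hyp; simpl; auto.
  - split.
    + intros H. apply All1I_inst. intros t. rewrite inst1_up. apply IHA, H.
    + intros H t. apply IHA. rewrite <- inst1_up. apply All1E, H.
  - split.
    + intros H. apply H; [apply incl_refl|]. intros t G' L K.
      apply Ex1I with t. rewrite inst1_up. apply IHA, K.
    + intros H C G' L K. eapply Ex1E_inst; [eapply prv_weaken; eauto|].
      intros t. apply (K t); auto using incl_tl, incl_refl.
      apply IHA. rewrite <- inst1_up. apply Hyp; simpl; auto.
Qed.

Lemma ev_intro A G : frc G (ev NVar FVar A) -> prv T G A.
Proof. rewrite ev_prv, sub_id; auto. Qed.

Lemma ev_ax A G : T A -> frc G (ev NVar FVar A).
Proof. intros H. apply ev_prv. rewrite sub_id. now apply Ax. Qed.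

Lemma ev_bim A G : BIM A -> frc G (ev NVar FVar A).
Proof. intros H. apply ev_ax, bim_ax, H. Qed.

(** Induction is available only for predicates that come from a formula, hence the equation relating
    [P] to [ev]. The induction step may take place in any larger context. *)
Lemma ev_ind (P : nterm -> Om T) A sigma tau G :
  (forall t, P t = ev (scons t sigma) tau A) ->
  frc G (P NZero) ->
  (forall G' t, incl G G' -> frc G' (P t) -> frc G' (P (Sc t))) ->
  forall t, frc G (P t).
Proof.
  intros E H0 HS t. rewrite E. apply ev_prv. rewrite <- inst0_up. apply All0E.
  eapply ImpE; [apply Ax, bim_ax, ax_ind|]. apply AndI.
  - rewrite inst0_up. apply ev_prv. now rewrite <- E.
  - apply All0I_inst; intros u. unfold inst0 at 1; cbn [sub].
    apply ImpI. change (sub (scons u NVar) FVar (sub (up0 sigma) tau A))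
      with (inst0 u (sub (up0 sigma) tau A)). rewrite inst0_up.
    replace (sub (scons u NVar) FVar
      (sub (scons (Sc #0) nvS) FVar (sub (up0 sigma) tau A)))
      with (sub (scons (Sc u) sigma) tau A).
    + apply ev_prv. rewrite <- E. apply HS; auto using incl_tl, incl_refl.
      rewrite E. apply ev_prv, Hyp; simpl; auto.
    + rewrite !sub_comp. apply sub_agree; intros n.
      * destruct n; simpl; auto. unfold nlift0; rewrite !nsub_comp.
        symmetry; apply nsub_id.
      * now rewrite !fsub_id.
Qed.

Lemma ev_repl (P : nterm -> Om T) A sigma tau G t u :
  (forall t, P t = ev (scons t sigma) tau A) ->
  frc G (oeq t u) -> frc G (P t) -> frc G (P u).
Proof.
  intros E H. rewrite !E, !ev_prv, <- !inst0_up. apply Eq0E, H.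
Qed.

(** * Equality *)

Definition eqn (G : list form) (t u : nterm) : Prop := frc G (oeq t u).

#[global] Instance eqn_equiv G : Equivalence (eqn G).
Proof.
  split.
  - intros t; apply Eq0I.
  - intros t u H.
    exact (ev_repl (P := fun x => oeq x t) (A := #0 ≈ #1)
      (sigma := scons t NVar) (tau := FVar) (fun _ => eq_refl) H (Eq0I T G t)).
  - intros t u v H K.
    exact (ev_repl (P := fun x => oeq t x) (A := #1 ≈ #0)
      (sigma := scons t NVar) (tau := FVar) (fun _ => eq_refl) K H).
Qed.

(** Equivalence at [G] alone would not be a congruence, because [oimp] and [oex] look at all larger
    contexts. *)
Definition omeq (G : list form) (P Q : Om T) : Prop :=
  forall G', incl G G' -> (frc G' P <-> frc G' Q).

#[global] Instance omeq_equiv G : Equivalence (omeq G).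
Proof.
  split.
  - intros P G' L; reflexivity.
  - intros P Q H G' L; symmetry; auto.
  - intros P Q R H K G' L; rewrite (H G' L); auto.
Qed.

#[global] Instance eqn_pair G : Proper (eqn G ==> eqn G ==> eqn G) NPair.
Proof.
  intros t t' H u u' K.
  apply (ev_repl (P := fun x => oeq (⟨t, u⟩) (⟨t', x⟩)) (A := ⟨#1, #2⟩ ≈ ⟨#3, #0⟩)
    (sigma := scons t (scons u (scons t' NVar))) (tau := FVar) (fun _ => eq_refl) K).
  apply (ev_repl (P := fun x => oeq (⟨t, u⟩) (⟨x, u⟩)) (A := ⟨#1, #2⟩ ≈ ⟨#0, #2⟩)
    (sigma := scons t (scons u NVar)) (tau := FVar) (fun _ => eq_refl) H).
  apply Eq0I.
Qed.

#[global] Instance eqn_app G f : Proper (eqn G ==> eqn G) (NApp f).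
Proof.
  intros t t' H.
  apply (ev_repl (P := fun x => oeq (f · t) (f · x)) (A := $0 · #1 ≈ $0 · #0)
    (sigma := scons t NVar) (tau := scons f FVar) (fun _ => eq_refl) H).
  apply Eq0I.
Qed.

#[global] Instance eqn_Sc G : Proper (eqn G ==> eqn G) Sc.
Proof. intros t u H; unfold Sc; now rewrite H. Qed.

Lemma eqn_mono G G' t u : incl G G' -> eqn G t u -> eqn G' t u.
Proof. apply frc_mono. Qed.

#[global] Instance frc_omeq G : Proper (omeq G ==> iff) (frc G).
Proof. intros P Q H. apply H, incl_refl. Qed.

#[global] Instance oeq_omeq G : Proper (eqn G ==> eqn G ==> omeq G) oeq.
Proof.
  intros t t' H u u' K G' L.
  apply (eqn_mono L) in H. apply (eqn_mono L) in K.
  change (eqn G' t u <-> eqn G' t' u'). now rewrite H, K.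
Qed.

#[global] Instance oand_omeq G : Proper (omeq G ==> omeq G ==> omeq G) oand.
Proof.
  intros P P' H Q Q' K G' L.
  change (frc G' P /\ frc G' Q <-> frc G' P' /\ frc G' Q').
  now rewrite (H G' L), (K G' L).
Qed.

#[global] Instance oimp_omeq G : Proper (omeq G ==> omeq G ==> omeq G) oimp.
Proof.
  intros P P' H Q Q' K G' L.
  split; intros M G2 L2 N; assert (L3 : incl G G2) by (eapply incl_tran; eauto);
    apply (K _ L3), M, (H _ L3), N; auto.
Qed.

#[global] Instance oall_omeq X G :
  Proper (pointwise_relation X (omeq G) ==> omeq G) oall.
Proof.
  intros P P' H G' L. split; intros M x; apply (H x G' L), M.
Qed.

#[global] Instance oex_omeq X G :
  Proper (pointwise_relation X (omeq G) ==> omeq G) oex.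
Proof.
  intros P P' H G' L. split; intros M; apply (ex_E M); intros x G2 L2 N;
    apply (@ex_I X _ _ x), (H x); auto; eapply incl_tran; eauto.
Qed.

#[global] Instance oor_omeq G : Proper (omeq G ==> omeq G ==> omeq G) oor.
Proof.
  intros P P' H Q Q' K. apply oex_omeq. intros [|]; auto.
Qed.

#[global] Instance onot_omeq G : Proper (omeq G ==> omeq G) onot.
Proof. intros P P' H. apply oimp_omeq; auto. reflexivity. Qed.

End Forcing.


(** * Tactics for reasoning at a context *)

Ltac onorm :=
  cbv beta in *;
  repeat match goal with
  | |- frc ?G (@oeq ?T ?t ?u) => change (@eqn T G t u)
  | H : frc ?G (@oeq ?T ?t ?u) |- _ => change (@eqn T G t u) in H
  end.

Ltac orefl := onorm; reflexivity.

(** Transports every forced hypothesis along [L] and forgets the old context, so that a proof speaks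
    of a single current context. *)
Ltac worldup L :=
  match type of L with
  | incl ?G ?G' =>
      repeat match goal with
      | H : frc G _ |- _ => apply (frc_mono L) in H
      | H : eqn G _ _ |- _ => apply (eqn_mono L) in H
      end;
      clear L; try (clear G; rename G' into G)
  end; onorm.

Tactic Notation "oi" simple_intropattern(p) :=
  let G' := fresh "G" in let L := fresh "L" in
  intros G' L p; worldup L.

Tactic Notation "od" constr(H) "as" ident(x) simple_intropattern(p) :=
  let G' := fresh "G" in let L := fresh "L" in
  refine (ex_E H _); try clear H; intros x G' L p; worldup L.

Tactic Notation "oc" constr(H) "as" simple_intropattern(p) "|" simple_intropattern(q) :=
  let G' := fresh "G" in let L := fresh "L" in
  refine (or_E H _ _); try clear H;
  [intros G' L p; worldup L|intros G' L q; worldup L].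

(** [A] is the goal as a formula in which [#0] stands for [t]; its other free
    variables are interpreted by [sigma] and [tau]. *)
Tactic Notation "oind" constr(t) "with" constr(A) constr(sigma) constr(tau) "as" ident(x) simple_intropattern(p) :=
  try match goal with |- @eqn ?T ?G ?a ?b => change (frc G (@oeq T a b)) end;
  match goal with
  | |- frc ?G ?Q =>
      let P := eval pattern t in Q in
      match P with ?P t =>
        let G' := fresh "G" in let L := fresh "L" in
        refine (@ev_ind _ _ P A sigma tau G (fun _ => eq_refl) _ _ t);
        try clear t; [|intros G' x L p; worldup L]; onorm
      end
  end.

Fixpoint env (l : list nterm) : nat -> nterm :=
  match l with [] => NVar | t :: l => scons t (env l) end.
Fixpoint fenv (l : list fterm) : nat -> fterm :=
  match l with [] => FVar | f :: l => scons f (fenv l) end.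

(** * Arithmetic *)

Definition add (t u : nterm) : nterm := FCst pAdd · ⟨t, u⟩.
Definition minus (t u : nterm) : nterm := FCst pSub · ⟨t, u⟩.

Section Arithmetic.
Context {T : theory} {HT : BIMTheory T}.
Implicit Types (G : list form) (t u v w x y : nterm).
Local Notation "t ≐ u" := (@oeq T t u) (at level 70).
Local Notation eqn := (@eqn T).

Definition lt (t u : nterm) : Om T := oex (fun x => Sc (add t x) ≐ u).
Definition le (t u : nterm) : Om T := lt t (Sc u).

#[global] Instance add_eqn G : Proper (eqn G ==> eqn G ==> eqn G) add.
Proof. intros t t' H u u' K; unfold add; now rewrite H, K. Qed.
#[global] Instance minus_eqn G : Proper (eqn G ==> eqn G ==> eqn G) minus.
Proof. intros t t' H u u' K; unfold minus; now rewrite H, K. Qed.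

#[global] Instance lt_omeq G : Proper (eqn G ==> eqn G ==> omeq G) lt.
Proof.
  intros t t' H u u' K; unfold lt. apply oex_omeq; intros x. now rewrite H, K.
Qed.
#[global] Instance le_omeq G : Proper (eqn G ==> eqn G ==> omeq G) le.
Proof. intros t t' H u u' K; unfold le. now rewrite H, K. Qed.

Lemma app_pZ G t : eqn G (FCst pZ · t) NZero.
Proof. exact (ev_bim G ax_zero t). Qed.
Lemma app_pI G t : eqn G (FCst pI · t) t.
Proof. exact (ev_bim G ax_id t). Qed.
Lemma app_pPair G f g t : eqn G (FCst (pPair f g) · t) (⟨FCst f · t, FCst g · t⟩).
Proof. exact (ev_bim G (ax_cst_pair f g) t). Qed.
Lemma app_pComp G f g t : eqn G (FCst (pComp f g) · t) (FCst f · (FCst g · t)).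
Proof. exact (ev_bim G (ax_cst_comp f g) t). Qed.
Lemma app_pRec0 G f g t : eqn G (FCst (pRec f g) · ⟨t, NZero⟩) (FCst f · t).
Proof. exact (ev_bim G (ax_cst_rec0 f g) t). Qed.
Lemma app_pRecS G f g t u :
  eqn G (FCst (pRec f g) · ⟨t, Sc u⟩) (FCst g · ⟨⟨t, u⟩, FCst (pRec f g) · ⟨t, u⟩⟩).
Proof. exact (ev_bim G (ax_cst_recS f g) t u). Qed.
Lemma app_pK G t u : eqn G (FCst pK · ⟨t, u⟩) t.
Proof. exact (ev_bim G ax_K t u). Qed.
Lemma app_pL G t u : eqn G (FCst pL · ⟨t, u⟩) u.
Proof. exact (ev_bim G ax_L t u). Qed.
Lemma pair_surj G t : eqn G (⟨FCst pK · t, FCst pL · t⟩) t.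
Proof. exact (ev_bim G ax_J_surj t). Qed.
Lemma pair_00 G : eqn G (⟨NZero, NZero⟩) NZero.
Proof. exact (ev_bim G ax_J00). Qed.
Lemma pair_0S G t : eqn G (⟨NZero, Sc t⟩) (Sc ⟨t, NZero⟩).
Proof. exact (ev_bim G ax_J0S t). Qed.
Lemma pair_S G t u : eqn G (⟨Sc t, u⟩) (Sc ⟨t, Sc u⟩).
Proof. exact (ev_bim G ax_JS t u). Qed.
Lemma Sc_inj G t u : eqn G (Sc t) (Sc u) -> eqn G t u.
Proof. exact (imp_E (ev_bim G ax_S_inj t u)). Qed.
Lemma Sc_neq0 G (P : Om T) t : eqn G (Sc t) NZero -> frc G P.
Proof. intros H. apply bot_E. exact (imp_E (ev_bim G ax_S_neq0 t) H). Qed.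

Lemma add_0_r G t : eqn G (add t NZero) t.
Proof. unfold add, pAdd. rewrite app_pRec0. apply app_pI. Qed.
Lemma add_S_r G t u : eqn G (add t (Sc u)) (Sc (add t u)).
Proof. unfold add, pAdd. now rewrite app_pRecS, app_pComp, app_pL. Qed.
Lemma add_0_l G t : eqn G (add NZero t) t.
Proof.
  oind t with (FCst pAdd · ⟨NZero, #0⟩ ≈ #0) (env []) (fenv []) as x H.
  - apply add_0_r.
  - now rewrite add_S_r, H.
Qed.
Lemma add_S_l G t u : eqn G (add (Sc t) u) (Sc (add t u)).
Proof.
  oind u with (FCst pAdd · ⟨Sc #1, #0⟩ ≈ Sc (FCst pAdd · ⟨#1, #0⟩))
    (env [t]) (fenv []) as x H.
  - now rewrite !add_0_r.
  - now rewrite !add_S_r, H.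
Qed.
Lemma add_comm G t u : eqn G (add t u) (add u t).
Proof.
  oind u with (FCst pAdd · ⟨#1, #0⟩ ≈ FCst pAdd · ⟨#0, #1⟩) (env [t]) (fenv []) as x H.
  - now rewrite add_0_r, add_0_l.
  - now rewrite add_S_r, add_S_l, H.
Qed.
Lemma add_assoc G t u v : eqn G (add (add t u) v) (add t (add u v)).
Proof.
  oind v with (FCst pAdd · ⟨FCst pAdd · ⟨#1, #2⟩, #0⟩
     ≈ FCst pAdd · ⟨#1, FCst pAdd · ⟨#2, #0⟩⟩) (env [t; u]) (fenv []) as x H.
  - now rewrite !add_0_r.
  - now rewrite !add_S_r, H.
Qed.

Lemma zero_or_S G t : frc G (oor (t ≐ NZero) (oex (fun x => t ≐ Sc x))).
Proof.
  oind t with (#0 ≈ NZero ∨ ∃₀ #1 ≈ Sc #0) (env []) (fenv []) as x _.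
  - apply or_I1; orefl.
  - apply or_I2, ex_I with x; orefl.
Qed.
(* [frc G P] unfolds to a product when [P] is existential, which would make all
   of [G], [t] and further arguments implicit. *)
Arguments zero_or_S G t : clear implicits.

Lemma lt_0 G t (P : Om T) : frc G (lt t NZero) -> frc G P.
Proof. intros H; od H as x Hx. exact (Sc_neq0 _ Hx). Qed.

Lemma lt_S G t u : frc G (lt t u) -> frc G (lt t (Sc u)).
Proof. intros H; od H as x Hx. apply ex_I with (Sc x); onorm. now rewrite add_S_r, Hx. Qed.

Lemma lt_succ G t : frc G (lt t (Sc t)).
Proof. apply ex_I with NZero; onorm. now rewrite add_0_r. Qed.

Lemma lt_0_S G t : frc G (lt NZero (Sc t)).
Proof. apply ex_I with t; onorm. now rewrite add_0_l. Qed.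

Lemma lt_SS G t u : frc G (lt t u) -> frc G (lt (Sc t) (Sc u)).
Proof. intros H; od H as x Hx. apply ex_I with x; onorm. now rewrite add_S_l, Hx. Qed.

Lemma lt_SS_inv G t u : frc G (lt (Sc t) (Sc u)) -> frc G (lt t u).
Proof.
  intros H; od H as x Hx. apply ex_I with x; onorm.
  apply Sc_inj. now rewrite <- add_S_l.
Qed.

Lemma lt_S_inv G t u : frc G (lt t (Sc u)) -> frc G (oor (lt t u) (t ≐ u)).
Proof.
  intros H; od H as x Hx. apply Sc_inj in Hx.
  oc (zero_or_S G x) as K | K.
  - apply or_I2; onorm. now rewrite <- Hx, K, add_0_r.
  - od K as y Hy. apply or_I1, ex_I with y; onorm. now rewrite <- Hx, Hy, add_S_r.
Qed.

Lemma lt_trans G t u v : frc G (lt t u) -> frc G (lt u v) -> frc G (lt t v).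
Proof.
  intros H K; od H as x Hx. od K as y Hy.
  apply ex_I with (Sc (add x y)); onorm.
  now rewrite <- Hy, <- Hx, add_S_r, add_S_l, add_assoc.
Qed.

Lemma lt_irrefl G t (P : Om T) : frc G (lt t t) -> frc G P.
Proof.
  intros H. apply bot_E. revert H. apply imp_E.
  oind t with (¬ Lt #0 #0) (env []) (fenv []) as x H; oi K.
  - exact (lt_0 _ K).
  - exact (imp_E H (lt_SS_inv K)).
Qed.

Lemma le_refl G t : frc G (le t t).
Proof. apply lt_succ. Qed.
Lemma lt_le G t u : frc G (lt t u) -> frc G (le t u).
Proof. apply lt_S. Qed.
Lemma le_0 G t : frc G (le NZero t).
Proof. apply lt_0_S. Qed.
Lemma le_SS G t u : frc G (le t u) -> frc G (le (Sc t) (Sc u)).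
Proof. apply lt_SS. Qed.
Lemma le_lt_trans G t u v : frc G (le t u) -> frc G (lt u v) -> frc G (lt t v).
Proof.
  intros H K. oc (lt_S_inv H) as M | M.
  - now apply lt_trans with u.
  - now rewrite M.
Qed.
Lemma lt_le_trans G t u v : frc G (lt t u) -> frc G (le u v) -> frc G (lt t v).
Proof.
  intros H K. oc (lt_S_inv K) as M | M.
  - now apply lt_trans with u.
  - now rewrite <- M.
Qed.
Lemma le_trans G t u v : frc G (le t u) -> frc G (le u v) -> frc G (le t v).
Proof. intros H K. now apply le_lt_trans with u. Qed.
Lemma lt_le_S G t u : frc G (lt t u) -> frc G (le (Sc t) u).
Proof. apply lt_SS. Qed.
Lemma le_S_lt G t u : frc G (le (Sc t) u) -> frc G (lt t u).
Proof. apply lt_SS_inv. Qed.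

Lemma le_or_lt G t u : frc G (oor (le t u) (lt u t)).
Proof.
  oind t with (Le #0 #1 ∨ Lt #1 #0) (env [u]) (fenv []) as x H.
  - apply or_I1, le_0.
  - oc H as H | H.
    + oc (lt_S_inv H) as K | K.
      * now apply or_I1, lt_le_S.
      * apply or_I2. rewrite K. apply lt_succ.
    + now apply or_I2, lt_S.
Qed.
Arguments le_or_lt G t u : clear implicits.

Lemma trichotomy G t u : frc G (oor (lt t u) (oor (t ≐ u) (lt u t))).
Proof.
  oc (le_or_lt G t u) as H | H.
  - oc (lt_S_inv H) as K | K.
    + now apply or_I1.
    + now apply or_I2, or_I1.
  - now apply or_I2, or_I2.
Qed.
Arguments trichotomy G t u : clear implicits.

Lemma lt_neq G t u (P : Om T) : frc G (lt t u) -> eqn G t u -> frc G P.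
Proof. intros H K; rewrite K in H. exact (lt_irrefl _ H). Qed.

Lemma eq_dec G t u : frc G (oor (t ≐ u) (onot (t ≐ u))).
Proof.
  oc (trichotomy G t u) as H | H.
  - apply or_I2; oi K. exact (lt_neq _ H K).
  - oc H as H | H.
    + now apply or_I1.
    + apply or_I2; oi K. refine (lt_neq _ H _); now symmetry.
Qed.

Lemma not_0 G t : frc G (onot (t ≐ NZero)) -> frc G (oex (fun x => t ≐ Sc x)).
Proof.
  intros H. oc (zero_or_S G t) as K | K; auto. apply bot_E. exact (imp_E H K).
Qed.

Lemma le_antisym G t u : frc G (le t u) -> frc G (le u t) -> eqn G t u.
Proof.
  intros H K. oc (lt_S_inv H) as M | M; auto.
  exact (lt_irrefl _ (lt_le_trans M K)).
Qed.

Lemma add_cancel_l G t u v : eqn G (add t u) (add t v) -> eqn G u v.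
Proof.
  apply imp_E.
  oind t with (FCst pAdd · ⟨#0, #1⟩ ≈ FCst pAdd · ⟨#0, #2⟩ ⇒ #1 ≈ #2)
    (env [u; v]) (fenv []) as x H; oi K.
  - now rewrite !add_0_l in K.
  - rewrite !add_S_l in K. exact (imp_E H (Sc_inj K)).
Qed.

Lemma le_add_l G t u : frc G (le t (add t u)).
Proof. apply ex_I with u; orefl. Qed.

Lemma le_ex G t u : frc G (le t u) -> frc G (oex (fun x => add t x ≐ u)).
Proof. intros H; od H as x Hx. apply ex_I with x. now apply Sc_inj. Qed.

Lemma lt_add G t t' u u' : frc G (lt t t') -> frc G (le u u') -> frc G (lt (add t u) (add t' u')).
Proof.
  intros H K. od H as x Hx. od (le_ex K) as y Hy.
  apply ex_I with (add x y); onorm. rewrite <- Hx, <- Hy, add_S_l.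
  rewrite !add_assoc, <- (add_assoc G u x y), (add_comm G u x), add_assoc. reflexivity.
Qed.

Lemma pred_S G t : eqn G (FCst pPred · Sc t) t.
Proof.
  unfold pPred. now rewrite app_pComp, app_pPair, app_pI, app_pRecS, app_pComp, app_pK, app_pL.
Qed.
Lemma pred_0 G : eqn G (FCst pPred · NZero) NZero.
Proof.
  unfold pPred. now rewrite app_pComp, app_pPair, app_pI, app_pRec0, !app_pZ.
Qed.

Lemma minus_0_r G t : eqn G (minus t NZero) t.
Proof. unfold minus, pSub. now rewrite app_pRec0, app_pI. Qed.
Lemma minus_S_r G t u : eqn G (minus t (Sc u)) (FCst pPred · minus t u).
Proof. unfold minus, pSub. now rewrite app_pRecS, app_pComp, app_pL. Qed.
Lemma minus_SS G t u : eqn G (minus (Sc t) (Sc u)) (minus t u).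
Proof.
  oind u with (FCst pSub · ⟨Sc #1, Sc #0⟩ ≈ FCst pSub · ⟨#1, #0⟩) (env [t]) (fenv []) as x H.
  - now rewrite minus_S_r, !minus_0_r, pred_S.
  - now rewrite minus_S_r, H, <- minus_S_r.
Qed.
Lemma minus_0_l G t : eqn G (minus NZero t) NZero.
Proof.
  oind t with (FCst pSub · ⟨NZero, #0⟩ ≈ NZero) (env []) (fenv []) as x H.
  - apply minus_0_r.
  - now rewrite minus_S_r, H, pred_0.
Qed.
Lemma minus_diag G t : eqn G (minus t t) NZero.
Proof.
  oind t with (FCst pSub · ⟨#0, #0⟩ ≈ NZero) (env []) (fenv []) as x H.
  - apply minus_0_r.
  - now rewrite minus_SS, H.
Qed.
Lemma minus_add G t u : eqn G (minus (add t u) t) u.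
Proof.
  oind t with (FCst pSub · ⟨FCst pAdd · ⟨#0, #1⟩, #0⟩ ≈ #1) (env [u]) (fenv []) as x H.
  - now rewrite minus_0_r, add_0_l.
  - now rewrite add_S_l, minus_SS, H.
Qed.
Lemma minus_add_0 G t u : eqn G (minus t (add t u)) NZero.
Proof.
  oind t with (FCst pSub · ⟨#0, FCst pAdd · ⟨#0, #1⟩⟩ ≈ NZero) (env [u]) (fenv []) as x H.
  - now rewrite minus_0_l.
  - now rewrite add_S_l, minus_SS, H.
Qed.
Lemma minus_le_0 G t u : frc G (le t u) -> eqn G (minus t u) NZero.
Proof. intros H; od (le_ex H) as x Hx. now rewrite <- Hx, minus_add_0. Qed.
Lemma minus_0_le G t u : eqn G (minus t u) NZero -> frc G (le t u).
Proof.
  intros H. oc (le_or_lt G t u) as K | K; auto.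
  od K as x Hx. rewrite <- Hx, <- add_S_r, minus_add in H. exact (Sc_neq0 _ H).
Qed.
Lemma add_minus G t u : frc G (le t u) -> eqn G (add t (minus u t)) u.
Proof. intros H; od (le_ex H) as x Hx. now rewrite <- Hx, minus_add. Qed.
Lemma minus_lt G t u : frc G (lt t u) -> eqn G (minus u t) (Sc (minus u (Sc t))).
Proof.
  intros H; od H as x Hx. now rewrite <- Hx, minus_SS, <- add_S_r, !minus_add.
Qed.

Lemma add_eq_0 G t u : eqn G (add t u) NZero -> eqn G t NZero /\ eqn G u NZero.
Proof.
  intros H. assert (eqn G u NZero).
  { oc (zero_or_S G u) as K | K; auto. od K as x Hx.
    rewrite Hx, add_S_r in H. exact (Sc_neq0 _ H). }
  split; auto. now rewrite H0, add_0_r in H.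
Qed.

Definition dist (t u : nterm) : nterm := add (minus t u) (minus u t).

#[global] Instance dist_eqn G : Proper (eqn G ==> eqn G ==> eqn G) dist.
Proof. intros t t' H u u' K; unfold dist; now rewrite H, K. Qed.

Lemma dist_diag G t : eqn G (dist t t) NZero.
Proof. unfold dist. now rewrite minus_diag, add_0_r. Qed.
Lemma dist_0 G t u : eqn G (dist t u) NZero -> eqn G t u.
Proof. intros [H K]%add_eq_0. apply le_antisym; now apply minus_0_le. Qed.

Lemma sg_0 G : eqn G (FCst pSg · NZero) NZero.
Proof. unfold pSg. now rewrite app_pComp, app_pPair, app_pI, app_pRec0, !app_pZ. Qed.
Lemma sg_S G t : eqn G (FCst pSg · Sc t) (Sc NZero).
Proof. unfold pSg. now rewrite app_pComp, app_pPair, app_pI, app_pRecS, app_pComp, app_pZ. Qed.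

(** * Pairing *)

Lemma le_pair_l G t u : frc G (le t ⟨t, u⟩).
Proof.
  revert u. change (frc G (oall (fun u => le t ⟨t, u⟩))).
  oind t with (∀₀ Le #1 ⟨#1, #0⟩) (env []) (fenv []) as x H; intros u.
  - apply le_0.
  - rewrite pair_S. apply le_SS, H.
Qed.

Lemma le_pair_r G t u : frc G (le u ⟨t, u⟩).
Proof.
  revert u. change (frc G (oall (fun u => le u ⟨t, u⟩))).
  oind t with (∀₀ Le #0 ⟨#1, #0⟩) (env []) (fenv []) as x H; intros u.
  - oc (zero_or_S G u) as K | K.
    + rewrite K. apply le_0.
    + od K as y Hy. rewrite Hy, pair_0S. apply le_SS, le_pair_l.
  - rewrite pair_S. apply lt_le, le_lt_trans with (Sc u); [apply lt_le, lt_succ|].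
    apply (H (Sc u)).
Qed.
End Arithmetic.

Arguments zero_or_S {T HT} G t.
Arguments lt_succ {T HT} G t.
Arguments le_refl {T HT} G t.
Arguments le_or_lt {T HT} G t u.
Arguments trichotomy {T HT} G t u.
Arguments eq_dec {T HT} G t u.
Arguments le_add_l {T HT} G t u.
Arguments le_pair_l {T HT} G t u.

(** * Functions *)

(** The condition counts as true when it is zero, in line with admission to a spread, which is
    [β(s) = 0]. *)
Definition pIf : prc := pRec pK (pComp pL (pComp pK pK)).
Definition ite (c t u : nterm) : nterm := FCst pIf · ⟨⟨t, u⟩, c⟩.

Section Functions.
Context {T : theory} {HT : BIMTheory T}.
Implicit Types (G : list form) (t u v w x y : nterm) (f g h : fterm).
Local Notation "t ≐ u" := (@oeq T t u) (at level 70).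
Local Notation eqn := (@eqn T).
Local Notation frc := (@frc T).

Lemma ite_0 G t u c : eqn G c NZero -> eqn G (ite c t u) t.
Proof. intros H; unfold ite, pIf. now rewrite H, app_pRec0, app_pK. Qed.
Lemma ite_S G t u c x : eqn G c (Sc x) -> eqn G (ite c t u) u.
Proof.
  intros H; unfold ite, pIf.
  now rewrite H, app_pRecS, !app_pComp, !app_pK, app_pL.
Qed.

#[global] Instance ite_eqn G : Proper (eqn G ==> eqn G ==> eqn G ==> eqn G) ite.
Proof. intros c c' E t t' H u u' K; unfold ite; now rewrite E, H, K. Qed.

(** The value [u] may contain variables, so no function constant need denote this function; it is
    obtained by internal induction on [u], composing with the successor. *)
Lemma const_ex G u : frc G (oex (fun f => oall (fun x => f · x ≐ u))).
Proof.
  oind u with (∃₁ ∀₀ $0 · #0 ≈ #1) (env []) (fenv []) as y H.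
  - apply ex_I with (FCst pZ); intros x. exact (app_pZ G x).
  - od H as f Hf. od (ev_bim G ax_comp (FCst pS) f) as g Hg.
    apply ex_I with g; intros x; onorm. rewrite (Hg x : eqn G _ _).
    change (eqn G (FCst pS · (f · x)) (Sc y)). now rewrite (Hf x : eqn G _ _).
Qed.

(** Explicit definition of functions, by induction on the term [e], in which [#0] is the argument.
    The closure axioms for pairing and composition handle the compound terms. *)
Lemma fun_ex e sigma tau G :
  frc G (oex (fun f => oall (fun x => f · x ≐ nsub (scons x sigma) tau e))).
Proof.
  induction e as [[|n]| |e1 IH1 e2 IH2|f e IH]; cbn [nsub scons].
  - apply ex_I with (FCst pI); intros x. exact (app_pI G x).
  - apply const_ex.
  - apply const_ex.
  - od IH1 as f1 H1. od IH2 as f2 H2. od (ev_bim G ax_pair f1 f2) as g Hg.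
    apply ex_I with g; intros x; onorm. rewrite (Hg x : eqn G _ _). cbn [nsub fsub scons].
    now rewrite (H1 x : eqn G _ _), (H2 x : eqn G _ _).
  - od IH as f1 H1. od (ev_bim G ax_comp (fsub tau f) f1) as g Hg.
    apply ex_I with g; intros x; onorm. rewrite (Hg x : eqn G _ _). cbn [nsub fsub scons].
    now rewrite (H1 x : eqn G _ _).
Qed.
Arguments fun_ex e sigma tau G : clear implicits.

Lemma rec_ex G f g :
  frc G (oex (fun h => oall (fun x => oand (h · ⟨x, NZero⟩ ≐ f · x)
    (oall (fun y => h · ⟨x, Sc y⟩ ≐ g · ⟨⟨x, y⟩, h · ⟨x, y⟩⟩))))).
Proof. exact (ev_bim G ax_rec f g). Qed.

Lemma search_ex G f :
  frc G (oall (fun x => oex (fun y => f · ⟨x, y⟩ ≐ NZero))) ->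
  frc G (oex (fun h => oall (fun x => oand (f · ⟨x, h · x⟩ ≐ NZero)
    (oall (fun y => oimp (lt y (h · x)) (onot (f · ⟨x, y⟩ ≐ NZero))))))).
Proof. exact (imp_E (ev_bim G ax_search f)). Qed.

(** By induction on [m] for all functions at once, since the induction step changes the function. *)
Lemma pigeonhole G m f (P : Om T) :
  frc G (oall (fun i => oimp (lt i (Sc m)) (lt (f · i) m))) ->
  frc G (oall (fun i => oall (fun j => oimp (lt i (Sc m)) (oimp (lt j (Sc m))
    (oimp (f · i ≐ f · j) (i ≐ j)))))) -> frc G P.
Proof.
  intros H K. apply bot_E. revert H K.
  enough (frc G (oall (fun f : fterm =>
    oimp (oall (fun i => oimp (lt i (Sc m)) (lt (f · i) m)))
    (oimp (oall (fun i => oall (fun j => oimp (lt i (Sc m)) (oimp (lt j (Sc m))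
    (oimp (f · i ≐ f · j) (i ≐ j)))))) obot)))) as M.
  { intros H K. exact (imp_E (imp_E (M f) H) K). }
  clear f.
  oind m with (∀₁ ((∀₀ (Lt #0 (Sc #1) ⇒ Lt ($0 · #0) #1))
    ⇒ (∀₀ ∀₀ (Lt #1 (Sc #2) ⇒ Lt #0 (Sc #2) ⇒ $0 · #1 ≈ $0 · #0 ⇒ #1 ≈ #0)) ⇒ Bot))
    (env []) (fenv []) as m IH; intros f; oi H; oi K.
  - exact (lt_0 _ (imp_E (H NZero) (lt_succ _ _))).
  - assert (E : frc G (oex (fun g => oall (fun i =>
      g · i ≐ ite (dist (f · i) m) (f · Sc m) (f · i)))))
      by exact (fun_ex (FCst pIf · ⟨⟨$0 · #1, $0 · #0⟩,
        FCst pAdd · ⟨FCst pSub · ⟨$0 · #0, #2⟩, FCst pSub · ⟨#2, $0 · #0⟩⟩⟩)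
        (env [Sc m; m]) (fenv [f]) G).
    od E as g Hg.
    assert (V : frc G (oall (fun i => oimp (lt i (Sc m)) (oor
       (oand (f · i ≐ m) (oand (g · i ≐ f · Sc m) (lt (f · Sc m) m)))
       (oand (g · i ≐ f · i) (lt (f · i) m)))))).
    { intros i; oi Hi.
      pose proof (Hg i : eqn G _ _) as Hgi. pose proof (lt_S Hi) as Hi'.
      oc (zero_or_S G (dist (f · i) m)) as D | D.
      - apply or_I1. pose proof (dist_0 D) as E. split; [exact E|].
        rewrite (ite_0 _ _ D) in Hgi. split; [exact Hgi|].
        oc (lt_S_inv (imp_E (H (Sc m)) (lt_succ G (Sc m)))) as M | M; auto.
        assert (N : eqn G (f · i) (f · Sc m)) by (rewrite E; now symmetry).
        pose proof (imp_E (imp_E (imp_E (K i (Sc m)) Hi') (lt_succ G _)) N) as Q; onorm.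
        rewrite Q in Hi. exact (lt_irrefl _ Hi).
      - apply or_I2. od D as y Hy. rewrite (ite_S _ _ Hy) in Hgi. split; [exact Hgi|].
        oc (lt_S_inv (imp_E (H i) Hi')) as M | M; auto.
        rewrite M, dist_diag in Hy. exact (Sc_neq0 _ (symmetry Hy)). }
    refine (imp_E (imp_E (IH g) _) _).
    + intros i; oi Hi. oc (imp_E (V i) Hi) as (_ & E & L) | (E & L); onorm; now rewrite E.
    + intros i j; oi Hi; oi Hj; oi E.
      pose proof (lt_S Hi) as Hi'. pose proof (lt_S Hj) as Hj'.
      oc (imp_E (V i) Hi) as (Ei & Ei' & _) | (Ei & _);
      oc (imp_E (V j) Hj) as (Ej & Ej' & _) | (Ej & _); onorm.
      * apply (imp_E (imp_E (imp_E (K i j) Hi') Hj')). onorm. now rewrite Ei, Ej.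
      * rewrite Ei', Ej in E. symmetry in E.
        pose proof (imp_E (imp_E (imp_E (K j (Sc m)) Hj') (lt_succ G _)) E) as Q; onorm.
        rewrite Q in Hj. exact (lt_irrefl _ Hj).
      * rewrite Ei, Ej' in E.
        pose proof (imp_E (imp_E (imp_E (K i (Sc m)) Hi') (lt_succ G _)) E) as Q; onorm.
        rewrite Q in Hi. exact (lt_irrefl _ Hi).
      * apply (imp_E (imp_E (imp_E (K i j) Hi') Hj')). onorm. now rewrite <- Ei, <- Ej.
Qed.
End Functions.

Arguments fun_ex {T HT} e sigma tau G.
Arguments rec_ex {T HT} G f g.

(** * Finite sequences *)

Definition par (s : nterm) : nterm := FCst pInit · s.
Definition last (s : nterm) : nterm := FCst pL · (FCst pPred · s).
Definition drop (s k : nterm) : nterm := FCst pDrop · ⟨s, k⟩.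
(** The recursion inside [pLen], isolated because the proofs need its value at bounds other than the
    code itself. *)
Definition pCnt : prc := pRec pZ (pComp pAdd (pPair pL (pComp pSg (pComp pDrop pK)))).
Definition cnt (s k : nterm) : nterm := FCst pCnt · ⟨s, k⟩.

Section Sequences.
Context {T : theory} {HT : BIMTheory T}.
Implicit Types (G : list form) (i k n s t u v w x y : nterm) (f g h : fterm).
Local Notation "t ≐ u" := (@oeq T t u) (at level 70).
Local Notation eqn := (@eqn T).
Local Notation frc := (@frc T).

#[global] Instance snoc_eqn G : Proper (eqn G ==> eqn G ==> eqn G) snoc.
Proof. intros t t' H u u' K; unfold snoc; now rewrite H, K. Qed.
#[global] Instance par_eqn G : Proper (eqn G ==> eqn G) par.
Proof. intros t t' H; unfold par; now rewrite H. Qed.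
#[global] Instance last_eqn G : Proper (eqn G ==> eqn G) last.
Proof. intros t t' H; unfold last; now rewrite H. Qed.
#[global] Instance len_eqn G : Proper (eqn G ==> eqn G) len.
Proof. intros t t' H; unfold len; now rewrite H. Qed.
#[global] Instance nth_eqn G : Proper (eqn G ==> eqn G ==> eqn G) nth.
Proof. intros t t' H u u' K; unfold nth; now rewrite H, K. Qed.
#[global] Instance drop_eqn G : Proper (eqn G ==> eqn G ==> eqn G) drop.
Proof. intros t t' H u u' K; unfold drop; now rewrite H, K. Qed.
#[global] Instance cnt_eqn G : Proper (eqn G ==> eqn G ==> eqn G) cnt.
Proof. intros t t' H u u' K; unfold cnt; now rewrite H, K. Qed.

Lemma par_snoc G s n : eqn G (par (snoc s n)) s.
Proof. unfold par, pInit, snoc. now rewrite app_pComp, pred_S, app_pK. Qed.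
Lemma last_snoc G s n : eqn G (last (snoc s n)) n.
Proof. unfold last, snoc. now rewrite pred_S, app_pL. Qed.
Lemma par_0 G : eqn G (par NZero) NZero.
Proof. unfold par, pInit. rewrite app_pComp, pred_0, <- pair_00 at 1. apply app_pK. Qed.
Lemma last_0 G : eqn G (last NZero) NZero.
Proof. unfold last. rewrite pred_0, <- pair_00 at 1. apply app_pL. Qed.

Lemma snoc_cases G s : frc G (oor (s ≐ NZero) (s ≐ snoc (par s) (last s))).
Proof.
  oc (zero_or_S G s) as H | H; [now apply or_I1|apply or_I2].
  od H as x Hx. onorm. unfold snoc, par, last, pInit.
  rewrite app_pComp, Hx, pred_S, pair_surj. reflexivity.
Qed.
Arguments snoc_cases G s : clear implicits.

Lemma snoc_inj1 G s n s' n' : eqn G (snoc s n) (snoc s' n') -> eqn G s s'.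
Proof. intros H. rewrite <- (par_snoc G s n), H. apply par_snoc. Qed.
Lemma snoc_inj2 G s n s' n' : eqn G (snoc s n) (snoc s' n') -> eqn G n n'.
Proof. intros H. rewrite <- (last_snoc G s n), H. apply last_snoc. Qed.

Lemma lt_snoc_l G s n : frc G (lt s (snoc s n)).
Proof. apply le_pair_l. Qed.
Lemma lt_snoc_r G s n : frc G (lt n (snoc s n)).
Proof. apply le_pair_r. Qed.

Lemma ev_sub sigma tau p q A G :
  frc G (ev sigma tau (sub p q A))
  <-> frc G (ev (fun j => nsub sigma tau (p j)) (fun j => fsub tau (q j)) A).
Proof. now rewrite !ev_prv, sub_comp. Qed.

(** A code exceeds the code of its initial part, so induction on sequences follows from numerical
    induction on a bound for the code. *)
Lemma seq_ind (P : nterm -> Om T) A sigma tau G :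
  (forall t, P t = ev (scons t sigma) tau A) ->
  frc G (P NZero) ->
  (forall G' s n, incl G G' -> frc G' (P s) -> frc G' (P (snoc s n))) ->
  forall t, frc G (P t).
Proof.
  intros E H0 HS t.
  (* [B] is [A] with index 1 left free for the bound [t]. *)
  set (B := sub (scons #0 (fun j => NVar (S (S j)))) FVar A).
  set (Q := fun s k => @ev T (scons s (scons k sigma)) tau B).
  assert (EQ : forall G s k, frc G (Q s k) <-> frc G (P s)).
  { intros G1 s k. unfold Q, B. rewrite ev_sub, E.
    rewrite !ev_prv. erewrite sub_agree; [reflexivity|now intros [|n]|].
    reflexivity. }
  enough (H : frc G (oall (fun s => oimp (le s t) (Q s t)))).
  { apply (EQ G t t). exact (imp_E (H t) (le_refl G t)). }
  apply (ev_ind (P := fun t => oall (fun s => oimp (le s t) (Q s t)))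
    (A := ∀₀ (Le #0 #1 ⇒ B)) (sigma := sigma) (tau := tau) (fun _ => eq_refl)).
  - clear HS. intros s; oi K. apply EQ. od (le_ex K) as x Hx.
    apply add_eq_0 in Hx as [Hs _].
    apply (ev_repl (t := NZero) E); [onorm; now symmetry|exact H0].
  - intros G1 u L IH s G2 L2 K. apply EQ.
    assert (L3 : incl G G2) by (eapply incl_tran; eauto).
    refine (or_E (snoc_cases G2 s) _ _); intros G3 L4 M.
    + apply (ev_repl (t := NZero) E); [onorm; now symmetry|].
      exact (frc_mono L4 (frc_mono L3 H0)).
    + apply (ev_repl (t := snoc (par s) (last s)) E); [onorm; now symmetry|].
      apply HS; [eapply incl_tran; eauto|].
      apply (EQ G3 _ u). refine (imp_E (frc_mono L4 (frc_mono L2 IH) (par s)) _).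
      apply (lt_SS_inv (t := par s)). apply (frc_mono L4) in K. unfold le in K.
      refine (le_lt_trans _ K). apply lt_SS. change (eqn G3 s (snoc (par s) (last s))) in M.
      rewrite M at 2. apply lt_snoc_l.
Qed.
End Sequences.

Tactic Notation "osind" constr(t) "with" constr(A) constr(sigma) constr(tau) "as" ident(x) ident(n) simple_intropattern(p) :=
  try match goal with |- @eqn ?T ?G ?a ?b => change (frc G (@oeq T a b)) end;
  match goal with
  | |- frc ?G ?Q =>
      let P := eval pattern t in Q in
      match P with ?P t =>
        let G' := fresh "G" in let L := fresh "L" in
        refine (@seq_ind _ _ P A sigma tau G (fun _ => eq_refl) _ _ t);
        try clear t; [|intros G' x n L p; worldup L]; onorm
      end
  end.

Arguments snoc_cases {T HT} G s.

Section Sequences2.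
Context {T : theory} {HT : BIMTheory T}.
Implicit Types (G : list form) (i k n s t u v w x y : nterm) (f g h : fterm).
Local Notation "t ≐ u" := (@oeq T t u) (at level 70).
Local Notation eqn := (@eqn T).
Local Notation frc := (@frc T).

Lemma drop_0 G s : eqn G (drop s NZero) s.
Proof. unfold drop, pDrop. now rewrite app_pRec0, app_pI. Qed.
Lemma drop_S G s k : eqn G (drop s (Sc k)) (par (drop s k)).
Proof. unfold drop, pDrop. now rewrite app_pRecS, app_pComp, app_pL. Qed.
Lemma drop_snoc G s n k : eqn G (drop (snoc s n) (Sc k)) (drop s k).
Proof.
  oind k with (FCst pDrop · ⟨snoc #1 #2, Sc #0⟩ ≈ FCst pDrop · ⟨#1, #0⟩)
    (env [s; n]) (fenv []) as k H.
  - now rewrite drop_S, !drop_0, par_snoc.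
  - now rewrite drop_S, H, <- drop_S.
Qed.
Lemma drop_nil G k : eqn G (drop NZero k) NZero.
Proof.
  oind k with (FCst pDrop · ⟨NZero, #0⟩ ≈ NZero) (env []) (fenv []) as k H.
  - apply drop_0.
  - now rewrite drop_S, H, par_0.
Qed.

Lemma drop_ge G s k : frc G (le s k) -> eqn G (drop s k) NZero.
Proof.
  enough (K : frc G (oall (fun k => oimp (le s k) (drop s k ≐ NZero))))
    by (intros H; exact (imp_E (K k) H)).
  osind s with (∀₀ (Le #1 #0 ⇒ FCst pDrop · ⟨#1, #0⟩ ≈ NZero))
    (env []) (fenv []) as s n IH; intros k'; oi H.
  - apply drop_nil.
  - oc (zero_or_S G k') as K | K.
    + rewrite K in H. exact (lt_0 _ (lt_SS_inv H)).
    + od K as y Hy. rewrite Hy, drop_snoc. refine (imp_E (IH y) _).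
      rewrite Hy in H. exact (le_trans (le_pair_l _ _ _) (lt_SS_inv H)).
Qed.

Lemma cnt_0 G s : eqn G (cnt s NZero) NZero.
Proof. unfold cnt, pCnt. now rewrite app_pRec0, app_pZ. Qed.
Lemma cnt_S G s k : eqn G (cnt s (Sc k)) (add (cnt s k) (FCst pSg · drop s k)).
Proof.
  unfold cnt, pCnt. now rewrite app_pRecS, !app_pComp, app_pPair, !app_pComp, app_pK, app_pL.
Qed.
Lemma cnt_snoc G s n k : eqn G (cnt (snoc s n) (Sc k)) (Sc (cnt s k)).
Proof.
  oind k with (FCst pCnt · ⟨snoc #1 #2, Sc #0⟩ ≈ Sc (FCst pCnt · ⟨#1, #0⟩))
    (env [s; n]) (fenv []) as k H.
  - rewrite cnt_S, !cnt_0, drop_0, add_0_l. apply sg_S.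
  - now rewrite cnt_S, H, drop_snoc, cnt_S, add_S_l.
Qed.
(** From stage [s] on nothing is left to count. This is needed for [len_snoc], where the entries of
    [s] are counted up to the larger bound coming from the code of the longer sequence. *)
Lemma cnt_stable G s k : eqn G (cnt s (add s k)) (cnt s s).
Proof.
  oind k with (FCst pCnt · ⟨#1, FCst pAdd · ⟨#1, #0⟩⟩ ≈ FCst pCnt · ⟨#1, #1⟩)
    (env [s]) (fenv []) as k H.
  - now rewrite add_0_r.
  - rewrite add_S_r, cnt_S, H, drop_ge by apply le_add_l. now rewrite sg_0, add_0_r.
Qed.

Lemma len_cnt G s : eqn G (len s) (cnt s s).
Proof. unfold len, pLen. now rewrite app_pComp, app_pPair, app_pI. Qed.
Lemma len_0 G : eqn G (len NZero) NZero.
Proof. rewrite len_cnt. apply cnt_0. Qed.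
Lemma len_snoc G s n : eqn G (len (snoc s n)) (Sc (len s)).
Proof.
  rewrite !len_cnt. unfold snoc at 2. rewrite cnt_snoc.
  od (le_ex (le_pair_l G s n)) as x Hx. now rewrite <- Hx, cnt_stable.
Qed.
Lemma len_eq_0 G s : eqn G (len s) NZero -> eqn G s NZero.
Proof.
  intros H. oc (snoc_cases G s) as K | K; auto.
  rewrite K, len_snoc in H. exact (Sc_neq0 _ H).
Qed.

Lemma nth_drop G s i : eqn G (nth s i) (last (drop s (minus (len s) (Sc i)))).
Proof.
  unfold nth, pNth.
  now rewrite !app_pComp, app_pPair, !app_pComp, app_pPair, !app_pComp, app_pK, app_pL.
Qed.
Lemma nth_last G s n : eqn G (nth (snoc s n) (len s)) n.
Proof. now rewrite nth_drop, len_snoc, minus_diag, drop_0, last_snoc. Qed.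
Lemma nth_snoc G s n i : frc G (lt i (len s)) -> eqn G (nth (snoc s n) i) (nth s i).
Proof.
  intros H. now rewrite !nth_drop, len_snoc, minus_SS, (minus_lt H), drop_snoc.
Qed.

Lemma seq_ext G s t :
  eqn G (len s) (len t) ->
  frc G (oall (fun i => oimp (lt i (len s)) (nth s i ≐ nth t i))) -> eqn G s t.
Proof.
  enough (K : frc G (oall (fun t => oimp (len s ≐ len t)
    (oimp (oall (fun i => oimp (lt i (len s)) (nth s i ≐ nth t i))) (s ≐ t)))))
    by (intros H M; exact (imp_E (imp_E (K t) H) M)).
  osind s with (∀₀ (len #1 ≈ len #0 ⇒ (∀₀ (Lt #0 (len #2) ⇒ nth #2 #0 ≈ nth #1 #0)) ⇒ #1 ≈ #0))
    (env []) (fenv []) as s n IH; intros t'; oi H; oi K.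
  - rewrite len_0 in H. symmetry. apply len_eq_0. now symmetry.
  - oc (snoc_cases G t') as M | M.
    + rewrite M, len_0, len_snoc in H. exact (Sc_neq0 _ H).
    + rewrite M. assert (E : eqn G (len s) (len (par t'))).
      { rewrite M, !len_snoc in H. now apply Sc_inj. }
      assert (E1 : eqn G s (par t')).
      { refine (imp_E (imp_E (IH _) E) _). intros i; oi Hi.
        pose proof (imp_E (K i)) as Q. rewrite len_snoc in Q.
        specialize (Q (lt_S Hi)). onorm.
        rewrite nth_snoc, M, nth_snoc in Q; auto. now rewrite <- E. }
      assert (E2 : eqn G n (last t')).
      { pose proof (imp_E (K (len s))) as Q. rewrite len_snoc in Q.
        specialize (Q (lt_succ _ _)). onorm. now rewrite nth_last, M, E, nth_last in Q. }
      now rewrite <- E1, <- E2.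
Qed.

(** * Initial parts *)

Definition restr g n s : Om T :=
  oand (len s ≐ n) (oall (fun i => oimp (lt i n) (nth s i ≐ g · i))).
Definition prefix s t : Om T :=
  oand (le (len s) (len t)) (oall (fun i => oimp (lt i (len s)) (nth s i ≐ nth t i))).

#[global] Instance restr_omeq G g : Proper (eqn G ==> eqn G ==> omeq G) (restr g).
Proof.
  intros n n' H s s' K. unfold restr. rewrite H, K. apply oand_omeq; [reflexivity|].
  apply oall_omeq; intros i. now rewrite H, K.
Qed.
#[global] Instance prefix_omeq G : Proper (eqn G ==> eqn G ==> omeq G) prefix.
Proof.
  intros n n' H s s' K. unfold prefix. rewrite H, K. apply oand_omeq; [reflexivity|].
  apply oall_omeq; intros i. now rewrite H, K.
Qed.

Lemma restr_0 G g : frc G (restr g NZero NZero).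
Proof. split; [apply len_0|]. intros i; oi H. exact (lt_0 _ H). Qed.

Lemma restr_S G g n s : frc G (restr g n s) -> frc G (restr g (Sc n) (snoc s (g · n))).
Proof.
  intros [H K]; onorm. split; onorm.
  - now rewrite len_snoc, H.
  - intros i; oi Hi. oc (lt_S_inv Hi) as M | M.
    + rewrite nth_snoc by now rewrite H. exact (imp_E (K i) M).
    + rewrite M, <- H. apply nth_last.
Qed.

Lemma restr_ex G g n : frc G (oex (fun s => restr g n s)).
Proof.
  oind n with (∃₀ (len #0 ≈ #1 ∧ ∀₀ (Lt #0 #2 ⇒ nth #1 #0 ≈ $0 · #0)))
    (env []) (fenv [g]) as n IH.
  - apply ex_I with NZero, restr_0.
  - od IH as s Hs. now apply ex_I with (snoc s (g · n)), restr_S.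
Qed.

Lemma restr_uniq G g n s t : frc G (restr g n s) -> frc G (restr g n t) -> eqn G s t.
Proof.
  intros [H K] [H' K']; onorm. apply seq_ext.
  - now rewrite H.
  - intros i; oi Hi. rewrite H in Hi.
    rewrite (imp_E (K i) Hi : eqn G _ _). symmetry. exact (imp_E (K' i) Hi).
Qed.

Lemma restr_S_inv G g n s :
  frc G (restr g (Sc n) s) -> frc G (oex (fun s' => oand (restr g n s') (s ≐ snoc s' (g · n)))).
Proof.
  intros H. od (restr_ex (g := g) (n := n) (G := G)) as s' Hs'. apply ex_I with s'.
  split; auto. eapply restr_uniq; [exact H|]. now apply restr_S.
Qed.

Lemma prefix_refl G s : frc G (prefix s s).
Proof. split; [apply le_refl|]. intros i; oi H. orefl. Qed.

Lemma prefix_snoc G s t x : frc G (prefix s t) -> frc G (prefix s (snoc t x)).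
Proof.
  intros [H K]; split; onorm.
  - rewrite len_snoc. now apply lt_S.
  - intros i; oi Hi. rewrite (imp_E (K i) Hi : eqn G _ _). symmetry; apply nth_snoc.
    now apply lt_le_trans with (len s).
Qed.

Lemma prefix_par G s t : frc G (prefix s (par t)) -> frc G (prefix s t).
Proof.
  intros H. oc (snoc_cases G t) as K | K.
  - rewrite K, par_0 in H. now rewrite K.
  - rewrite K. now apply prefix_snoc.
Qed.

Lemma prefix_snoc_inv G s t x :
  frc G (prefix s (snoc t x)) -> frc G (oor (prefix s t) (s ≐ snoc t x)).
Proof.
  intros [H K]; onorm. rewrite len_snoc in H. oc (lt_S_inv H) as M | M.
  - apply or_I1. split; auto. intros i; oi Hi.
    rewrite (imp_E (K i) Hi : eqn G _ _). apply nth_snoc. now apply lt_le_trans with (len s).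
  - apply or_I2, seq_ext; auto. now rewrite len_snoc.
Qed.

(** * Recursion on sequences *)

(** The theory has recursion on numbers only. Here [h · ⟨s, k⟩] runs over the first [k] entries of
    [s], the initial part of length [k] being obtained by dropping [len s - k] entries, and the
    result is read off at [k = len s]. *)
Lemma seqrec_ex G g :
  frc G (oex (fun h => oand (h · NZero ≐ NZero)
    (oall (fun s => oall (fun v => h · snoc s v ≐ g · ⟨h · s, snoc s v⟩))))).
Proof.
  assert (E : frc G (oex (fun g' => oall (fun x => g' · x ≐ g · ⟨FCst pL · x,
      drop (FCst pK · (FCst pK · x)) (minus (len (FCst pK · (FCst pK · x))) (Sc (FCst pL · (FCst pK · x))))⟩))))
    by exact (fun_ex ($0 · ⟨FCst pL · #0, FCst pDrop · ⟨FCst pK · (FCst pK · #0),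
      FCst pSub · ⟨len (FCst pK · (FCst pK · #0)), Sc (FCst pL · (FCst pK · #0))⟩⟩⟩)
      (env []) (fenv [g]) G).
  od E as g' Hg. od (rec_ex G (FCst pZ) g') as h Hh.
  assert (H0 : frc G (oall (fun s => h · ⟨s, NZero⟩ ≐ NZero))).
  { intros s. destruct (Hh s) as [M _]; onorm. now rewrite M, app_pZ. }
  assert (HS : frc G (oall (fun s => oall (fun k => h · ⟨s, Sc k⟩
      ≐ g · ⟨h · ⟨s, k⟩, drop s (minus (len s) (Sc k))⟩)))).
  { intros s k. destruct (Hh s) as [_ M]. specialize (M k); onorm.
    rewrite M, (Hg _ : eqn G _ _). now rewrite app_pL, !app_pK, app_pL. }
  clear Hh Hg g'.
  (* Stages up to [len s] do not see an entry appended to [s]. *)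
  assert (K : frc G (oall (fun s => oall (fun v => oall (fun k =>
    oimp (le k (len s)) (h · ⟨snoc s v, k⟩ ≐ h · ⟨s, k⟩)))))).
  { intros s v k.
    oind k with (Le #0 (len #1) ⇒ $0 · ⟨snoc #1 #2, #0⟩ ≈ $0 · ⟨#1, #0⟩)
      (env [s; v]) (fenv [h]) as k IH; oi M.
    - now rewrite (H0 (snoc s v) : eqn G _ _), (H0 s : eqn G _ _).
    - rewrite (HS (snoc s v) k : eqn G _ _), (HS s k : eqn G _ _).
      rewrite (imp_E IH (lt_le (le_S_lt M)) : eqn G _ _).
      now rewrite len_snoc, minus_SS, (minus_lt (le_S_lt M)), drop_snoc. }
  assert (E : frc G (oex (fun q => oall (fun x => q · x ≐ h · ⟨x, len x⟩))))
    by exact (fun_ex ($0 · ⟨#0, len #0⟩) (env []) (fenv [h]) G).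
  od E as w Hw. apply ex_I with w. split.
  - onorm. rewrite (Hw NZero : eqn G _ _), len_0. apply H0.
  - intros s v; onorm. rewrite (Hw s : eqn G _ _), (Hw (snoc s v) : eqn G _ _).
    rewrite len_snoc, (HS (snoc s v) (len s) : eqn G _ _), len_snoc, minus_diag, drop_0.
    now rewrite (imp_E (K s v (len s)) (le_refl _ _) : eqn G _ _).
Qed.
End Sequences2.

Arguments seqrec_ex {T HT} G g.

(** * Markov's principle and almost-finite sets *)

Section Markov.
Context {T : theory} {HT : BIMTheory T}.
Implicit Types (G : list form) (i k n s t u v w x y : nterm) (a f g h z : fterm).
Local Notation "t ≐ u" := (@oeq T t u) (at level 70).
Local Notation eqn := (@eqn T).
Local Notation frc := (@frc T).

(** This and the later semantic predicates are convertible to the interpretations of the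
    corresponding formulas, so a [change] suffices to pass between them. *)
Definition incr z : Om T := oall (fun n => lt (z · n) (z · Sc n)).
Definition ind a t : Om T := onot (a · t ≐ NZero).
Definition almfin a : Om T :=
  oall (fun z => oimp (incr z) (oex (fun n => onot (ind a (z · n))))).
Definition notnotfin a : Om T :=
  onot (onot (oex (fun n => oall (fun m => oimp (lt n m) (onot (ind a m)))))).
Definition mp1 : Om T :=
  oall (fun a => oimp (onot (onot (oex (fun n => ind a n)))) (oex (fun n => ind a n))).

Lemma neq_0 G t x : eqn G t (Sc x) -> frc G (onot (t ≐ NZero)).
Proof. intros H; oi K. rewrite H in K. exact (Sc_neq0 _ K). Qed.

Lemma dne_eq G t u : frc G (onot (onot (t ≐ u))) -> eqn G t u.
Proof.
  intros H. oc (eq_dec G t u) as K | K; auto. apply bot_E. exact (imp_E H K).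
Qed.

Lemma notnot_I G (P : Om T) : frc G P -> frc G (onot (onot P)).
Proof. intros H; oi K. exact (imp_E K H). Qed.

#[global] Instance ind_omeq G a : Proper (eqn G ==> omeq G) (ind a).
Proof. intros t u H; unfold ind; now rewrite H. Qed.

Lemma incr_le G z n : frc G (incr z) -> frc G (le n (z · n)).
Proof.
  intros H. oind n with (Le #0 ($0 · #0)) (env []) (fenv [z]) as n IH.
  - apply le_0.
  - apply lt_le_S. exact (le_lt_trans IH (H n)).
Qed.

(** Search replaces choice, as membership in [D_a] is decidable: [h x] is an element of [D_a] above
    [x], and [z] iterates [h] starting from [h 0]. *)
Lemma enum_ex G a :
  frc G (oall (fun n => oex (fun m => oand (lt n m) (ind a m)))) ->
  frc G (oex (fun z => oand (incr z) (oall (fun n => ind a (z · n))))).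
Proof.
  intros H.
  (* The sum vanishes at [⟨x, y⟩] exactly when [x < y] and [y] is in [D_a]. *)
  assert (E : frc G (oex (fun f => oall (fun p => f · p ≐
      add (minus (Sc (FCst pK · p)) (FCst pL · p)) (minus (Sc NZero) (a · (FCst pL · p)))))))
    by exact (fun_ex (FCst pAdd · ⟨FCst pSub · ⟨Sc (FCst pK · #0), FCst pL · #0⟩,
      FCst pSub · ⟨Sc NZero, $0 · (FCst pL · #0)⟩⟩) (env []) (fenv [a]) G).
  od E as f Hf.
  assert (S : frc G (oall (fun x => oex (fun y => f · ⟨x, y⟩ ≐ NZero)))).
  { intros x. od (H x) as y (L & N). apply ex_I with y; onorm.
    rewrite (Hf _ : eqn G _ _), app_pK, app_pL, (minus_le_0 (lt_le_S L)).
    od (not_0 N) as x' Hx'. now rewrite Hx', minus_SS, minus_0_l, add_0_l. }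
  apply search_ex in S. od S as h Hh.
  assert (K : frc G (oall (fun x => oand (lt x (h · x)) (ind a (h · x))))).
  { intros x. destruct (Hh x) as [E _]; onorm.
    rewrite (Hf _ : eqn G _ _), app_pK, app_pL in E. apply add_eq_0 in E as [E1 E2].
    split.
    - apply le_S_lt. now apply minus_0_le.
    - oi N. rewrite N, minus_0_r in E2. exact (Sc_neq0 _ E2). }
  clear Hh Hf f H.
  assert (E : frc G (oex (fun g => oall (fun p => g · p ≐ h · (FCst pL · p)))))
    by exact (fun_ex ($0 · (FCst pL · #0)) (env []) (fenv [h]) G).
  od E as g Hg. od (rec_ex G h g) as r Hr.
  assert (E : frc G (oex (fun z => oall (fun n => z · n ≐ r · ⟨NZero, n⟩))))
    by exact (fun_ex ($0 · ⟨NZero, #0⟩) (env []) (fenv [r]) G).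
  od E as z Hz. destruct (Hr NZero) as [R0 RS]; onorm.
  assert (ZS : frc G (oall (fun n => z · Sc n ≐ h · (z · n)))).
  { intros n; onorm. rewrite (Hz (Sc n) : eqn G _ _), (RS n : eqn G _ _), (Hg _ : eqn G _ _).
    now rewrite app_pL, (Hz n : eqn G _ _). }
  apply ex_I with z. split.
  - intros n. rewrite (ZS n : eqn G _ _). exact (proj1 (K (z · n))).
  - intros n. oc (zero_or_S G n) as E | E.
    + rewrite E, (Hz NZero : eqn G _ _), R0. exact (proj2 (K NZero)).
    + od E as k Hk. rewrite Hk, (ZS k : eqn G _ _). exact (proj2 (K (z · k))).
Qed.

Lemma unbounded_not_almfin G a (P : Om T) :
  frc G (oall (fun n => oex (fun m => oand (lt n m) (ind a m)))) ->
  frc G (almfin a) -> frc G P.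
Proof.
  intros H K. od (enum_ex H) as z (I & N). od (imp_E (K z) I) as n M.
  apply bot_E. exact (imp_E M (N n)).
Qed.

(** If no bound exists, then for each [n] it is impossible that [D_a] has no element above [n];
    Markov's Principle produces one, and an unbounded set is not almost-finite. *)
Lemma almfin_notnotfin G a : frc G mp1 -> frc G (almfin a) -> frc G (notnotfin a).
Proof.
  intros MP H; oi N. refine (unbounded_not_almfin _ _ H). clear H. intros n.
  (* [f] is [a] cut off to 0 at arguments up to [n]. *)
  assert (E : frc G (oex (fun f => oall (fun m =>
      f · m ≐ ite (minus (Sc n) m) (a · m) NZero))))
    by exact (fun_ex (FCst pIf · ⟨⟨$0 · #0, NZero⟩, FCst pSub · ⟨Sc #1, #0⟩⟩)
      (env [n]) (fenv [a]) G).
  od E as f Hf.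
  enough (Q : frc G (oex (fun m => ind f m))).
  { od Q as m Hm. apply ex_I with m. unfold ind in Hm. rewrite (Hf m : eqn G _ _) in Hm.
    oc (zero_or_S G (minus (Sc n) m)) as D | D.
    - rewrite ite_0 in Hm by exact D. split; auto. now apply le_S_lt, minus_0_le.
    - od D as y Hy. apply bot_E, (imp_E Hm). exact (ite_S _ _ Hy). }
  apply (imp_E (MP f)). oi Q. refine (imp_E N _). apply ex_I with n. intros m; oi L.
  oi Z. apply (imp_E Q). apply ex_I with m. unfold ind.
  now rewrite (Hf m : eqn G _ _), ite_0 by now apply minus_le_0, lt_le_S.
Qed.

(** Since [ζ(n) ∉ D_a] is decidable, Markov's Principle allows the doubly negated bound to be used
    as if it were given. *)
Lemma notnotfin_almfin G a : frc G mp1 -> frc G (notnotfin a) -> frc G (almfin a).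
Proof.
  intros MP H z; oi I.
  assert (E : frc G (oex (fun f => oall (fun n => f · n ≐ minus (Sc NZero) (a · (z · n))))))
    by exact (fun_ex (FCst pSub · ⟨Sc NZero, $0 · ($1 · #0)⟩) (env []) (fenv [a; z]) G).
  od E as f Hf.
  enough (Q : frc G (oex (fun n => ind f n))).
  { od Q as n Hn. apply ex_I with n. apply notnot_I. unfold ind in Hn.
    rewrite (Hf n : eqn G _ _) in Hn. oc (zero_or_S G (a · (z · n))) as D | D; auto.
    od D as y Hy. apply bot_E, (imp_E Hn); onorm. now rewrite Hy, minus_SS, minus_0_l. }
  apply (imp_E (MP f)). oi Q. refine (imp_E H _). oi F. od F as n Hn.
  (* The successor matters: [incr_le] gives only [k ≤ z(k)], and the bound has to be exceeded
     strictly. *)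
  assert (L : frc G (lt n (z · Sc n))) by (apply le_S_lt; now apply incr_le).
  refine (imp_E (imp_E (Hn _) L) _). oi E. refine (imp_E Q _).
  apply ex_I with (Sc n). unfold ind.
  apply neq_0 with NZero. now rewrite (Hf _ : eqn G _ _), E, minus_0_r.
Qed.

(** Let [D_b] consist of the [n] such that [a] vanishes below [n]. If [a] is not everywhere zero,
    then [D_b] is not-not bounded; an [n] outside [D_b] leaves finitely many places to look for a
    nonzero value of [a]. *)
Lemma notnotfin_mp1 G :
  frc G (oall (fun a => oimp (notnotfin a) (almfin a))) -> frc G mp1.
Proof.
  intros H a; oi N.
  assert (E : frc G (oex (fun g => oall (fun p => g · p ≐
      add (FCst pL · p) (a · (FCst pL · (FCst pK · p)))))))
    by exact (fun_ex (FCst pAdd · ⟨FCst pL · #0, $0 · (FCst pL · (FCst pK · #0))⟩)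
      (env []) (fenv [a]) G).
  od E as g Hg. od (rec_ex G (FCst pZ) g) as r Hr.
  destruct (Hr NZero) as [R0 RS]; onorm. rewrite app_pZ in R0.
  (* [r · ⟨NZero, n⟩] is the sum of the values of [a] below [n]. *)
  assert (S : frc G (oall (fun n => r · ⟨NZero, Sc n⟩ ≐ add (r · ⟨NZero, n⟩) (a · n)))).
  { intros n; onorm. rewrite (RS n : eqn G _ _), (Hg _ : eqn G _ _).
    now rewrite !app_pL, app_pK, app_pL. }
  clear Hr RS Hg g.
  assert (E : frc G (oex (fun b => oall (fun n => b · n ≐ minus (Sc NZero) (r · ⟨NZero, n⟩)))))
    by exact (fun_ex (FCst pSub · ⟨Sc NZero, $0 · ⟨NZero, #0⟩⟩) (env []) (fenv [r]) G).
  od E as b Hb.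
  assert (NF : frc G (notnotfin b)).
  { oi Q. refine (imp_E N _). oi E. od E as n Hn. refine (imp_E Q _).
    apply ex_I with n. intros m; oi L. apply notnot_I; onorm.
    od L as x Hx. rewrite (Hb _ : eqn G _ _), <- Hx, <- add_S_l.
    enough (D : frc G (onot (r · ⟨NZero, add (Sc n) x⟩ ≐ NZero))).
    { od (not_0 D) as y Hy. now rewrite Hy, minus_SS, minus_0_l. }
    clear Hx.
    oind x with ($0 · ⟨NZero, FCst pAdd · ⟨Sc #1, #0⟩⟩ ≉ NZero) (env [n]) (fenv [r]) as x IH;
      oi K.
    - rewrite add_0_r, (S n : eqn G _ _) in K. apply add_eq_0 in K as [_ K]. exact (imp_E Hn K).
    - rewrite add_S_r, (S _ : eqn G _ _) in K. apply add_eq_0 in K as [K _]. exact (imp_E IH K). }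
  (* Along the identity, almost-finiteness yields a number outside [D_b]. *)
  assert (I : frc G (incr (FCst pI))).
  { intros n. rewrite !app_pI. apply lt_succ. }
  od (imp_E (imp_E (H b) NF (FCst pI)) I) as n Hn. apply dne_eq in Hn.
  rewrite app_pI, (Hb _ : eqn G _ _) in Hn.
  enough (D : frc G (oor (r · ⟨NZero, n⟩ ≐ NZero) (oex (fun i => ind a i)))).
  { oc D as D | D; auto. rewrite D, minus_0_r in Hn. exact (Sc_neq0 _ Hn). }
  clear Hn.
  oind n with ($0 · ⟨NZero, #0⟩ ≈ NZero ∨ ∃₀ $1 · #0 ≉ NZero) (env []) (fenv [r; a]) as n IH.
  - now apply or_I1.
  - oc IH as IH | IH; [|now apply or_I2].
    oc (eq_dec G (a · n) NZero) as D | D.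
    + apply or_I1; onorm. now rewrite (S n : eqn G _ _), IH, D, add_0_r.
    + apply or_I2. now apply ex_I with n.
Qed.
End Markov.

Lemma BIM_theory : BIMTheory BIM.
Proof. split; auto using BIM_sub_closed. Qed.

Lemma MP1_iff_almost_finite : BIM ⊢ (MP1 ⇔ ∀₁ (AlmostFinite $0 ⇔ NotNotFinite $0)).
Proof.
  pose proof BIM_theory as HT. apply ev_intro.
  change (frc nil (oiff (@mp1 BIM) (oall (fun a => oiff (almfin a) (notnotfin a))))).
  split.
  - oi MP. intros a; split; oi H.
    + now apply almfin_notnotfin.
    + now apply notnotfin_almfin.
  - oi H. apply notnotfin_mp1. intros a; oi K. exact (iff2 (H a) K).
Qed.

(** * The left-child right-sibling tree of a spread-law *)

(** The predecessor [lcrs q u] of a node [u = p * <i>] is its nearest admitted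
    left sibling [p * <j>], [j < i], and [p] itself if there is none. *)
Definition lcrs (q : fterm) (u : nterm) : nterm := q · ⟨par u, last u⟩.
Definition pPow : prc :=
  pComp (pRec (pComp pS pZ) (pComp pAdd (pPair pL pL))) (pPair pZ pI).
Definition pow (n : nterm) : nterm := FCst pPow · n.

Section Tree.
Context {T : theory} {HT : BIMTheory T}.
Implicit Types (G : list form) (i j k n p s t u v x y : nterm) (a b f g h q w z : fterm).
Local Notation "t ≐ u" := (@oeq T t u) (at level 70).
Local Notation eqn := (@eqn T).
Local Notation frc := (@frc T).

Definition spreadlaw b : Om T :=
  oall (fun s => oiff (b · s ≐ NZero) (oex (fun n => b · snoc s n ≐ NZero))).
Definition incrseq m s : Om T :=
  oand (len s ≐ m) (oall (fun i => oimp (lt (Sc i) m) (lt (nth s i) (nth s (Sc i))))).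
Definition appfan b : Om T :=
  oand (spreadlaw b) (oall (fun n => oex (fun m => oall (fun s => oimp (incrseq m s)
    (oex (fun i => oand (lt i m)
      (oor (onot (b · nth s i ≐ NZero)) (onot (len (nth s i) ≐ n))))))))).

#[global] Instance lcrs_eqn G q : Proper (eqn G ==> eqn G) (lcrs q).
Proof. intros t u H; unfold lcrs; now rewrite H. Qed.
#[global] Instance pow_eqn G : Proper (eqn G ==> eqn G) pow.
Proof. intros t u H; unfold pow; now rewrite H. Qed.

Definition scan b q : Om T :=
  oall (fun p => oand (q · ⟨p, NZero⟩ ≐ p) (oall (fun j =>
    q · ⟨p, Sc j⟩ ≐ ite (b · snoc p j) (snoc p j) (q · ⟨p, j⟩)))).

Lemma scan_ex G b : frc G (oex (fun q => scan b q)).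
Proof.
  assert (E : frc G (oex (fun g => oall (fun x =>
      g · x ≐ ite (b · Sc (FCst pK · x)) (Sc (FCst pK · x)) (FCst pL · x)))))
    by exact (fun_ex (FCst pIf · ⟨⟨Sc (FCst pK · #0), FCst pL · #0⟩,
      $0 · Sc (FCst pK · #0)⟩) (env []) (fenv [b]) G).
  od E as g Hg. od (rec_ex G (FCst pI) g) as q Hq. apply ex_I with q.
  intros p. destruct (Hq p) as [H0 HS]; onorm. split.
  - onorm. now rewrite H0, app_pI.
  - intros j; onorm. rewrite (HS j : eqn G _ _), (Hg _ : eqn G _ _).
    now rewrite app_pK, app_pL.
Qed.

Section Scan.
Context (b q : fterm).

Lemma scan_0 G p : frc G (scan b q) -> eqn G (q · ⟨p, NZero⟩) p.
Proof. intros H. exact (proj1 (H p)). Qed.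

Lemma scan_hit G p j :
  frc G (scan b q) -> eqn G (b · snoc p j) NZero -> eqn G (q · ⟨p, Sc j⟩) (snoc p j).
Proof.
  intros H K. rewrite (proj2 (H p) j : eqn G _ _). now apply ite_0.
Qed.

Lemma scan_miss G p j :
  frc G (scan b q) -> frc G (onot (b · snoc p j ≐ NZero)) ->
  eqn G (q · ⟨p, Sc j⟩) (q · ⟨p, j⟩).
Proof.
  intros H K. rewrite (proj2 (H p) j : eqn G _ _).
  od (not_0 K) as x Hx. exact (ite_S _ _ Hx).
Qed.

Lemma scan_form G p j :
  frc G (scan b q) ->
  frc G (oor (q · ⟨p, j⟩ ≐ p) (oex (fun i => oand (lt i j) (q · ⟨p, j⟩ ≐ snoc p i)))).
Proof.
  intros H.
  oind j with ($1 · ⟨#1, #0⟩ ≈ #1 ∨ ∃₀ (Lt #0 #1 ∧ $1 · ⟨#2, #1⟩ ≈ snoc #2 #0))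
    (env [p]) (fenv [b; q]) as j IH.
  - apply or_I1. exact (scan_0 _ H).
  - oc (eq_dec G (b · snoc p j) NZero) as D | D.
    + apply or_I2, ex_I with j. split; [apply lt_succ|exact (scan_hit H D)].
    + oc IH as E | E.
      * apply or_I1; onorm. now rewrite (scan_miss H D).
      * apply or_I2. od E as i (L & E). apply ex_I with i.
        split; [now apply lt_S|onorm; now rewrite (scan_miss H D)].
Qed.

Lemma scan_after G p i j :
  frc G (scan b q) -> eqn G (b · snoc p i) NZero -> frc G (lt i j) ->
  frc G (oex (fun k => oand (le i k) (q · ⟨p, j⟩ ≐ snoc p k))).
Proof.
  intros H K. apply imp_E.
  oind j with (Lt #2 #0 ⇒ ∃₀ (Le #3 #0 ∧ $1 · ⟨#2, #1⟩ ≈ snoc #2 #0))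
    (env [p; i]) (fenv [b; q]) as j IH; oi L.
  - exact (lt_0 _ L).
  - oc (eq_dec G (b · snoc p j) NZero) as D | D.
    + apply ex_I with j. split; [exact L|exact (scan_hit H D)].
    + oc (lt_S_inv L) as M | M.
      * od (imp_E IH M) as k (L' & E). apply ex_I with k.
        split; [exact L'|onorm; now rewrite (scan_miss H D)].
      * apply bot_E, (imp_E D). onorm. now rewrite <- M.
Qed.

Lemma scan_lt_neq G p i j (P : Om T) :
  frc G (scan b q) -> eqn G (b · snoc p i) NZero -> frc G (lt i j) ->
  eqn G (q · ⟨p, i⟩) (q · ⟨p, j⟩) -> frc G P.
Proof.
  intros H K L E. od (scan_after H K L) as k (L' & E'). onorm. rewrite E' in E.
  oc (scan_form (p := p) (j := i) H) as M | M.
  - refine (lt_neq _ (lt_snoc_l (G := G) (s := p) (n := k)) _). now rewrite <- E.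
  - od M as m (L2 & M). onorm. rewrite E in M. rewrite <- (snoc_inj2 M) in L2.
    exact (lt_irrefl _ (lt_le_trans L2 L')).
Qed.

Lemma scan_inj G p i j :
  frc G (scan b q) -> eqn G (b · snoc p i) NZero -> eqn G (b · snoc p j) NZero ->
  eqn G (q · ⟨p, i⟩) (q · ⟨p, j⟩) -> eqn G i j.
Proof.
  intros H K K' E. oc (trichotomy G i j) as L | L.
  - exact (scan_lt_neq _ H K L E).
  - oc L as L | L; auto. symmetry in E. exact (scan_lt_neq _ H K' L E).
Qed.

Lemma scan_child G p n :
  frc G (scan b q) -> eqn G (b · snoc p n) NZero ->
  frc G (oex (fun i => oand (q · ⟨p, i⟩ ≐ p) (b · snoc p i ≐ NZero))).
Proof.
  intros H K.
  enough (M : frc G (oor (q · ⟨p, n⟩ ≐ p)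
    (oex (fun i => oand (q · ⟨p, i⟩ ≐ p) (b · snoc p i ≐ NZero))))).
  { oc M as M | M; auto. apply ex_I with n. now split. }
  clear K.
  oind n with ($1 · ⟨#1, #0⟩ ≈ #1 ∨ ∃₀ ($1 · ⟨#2, #0⟩ ≈ #2 ∧ $0 · snoc #2 #0 ≈ NZero))
    (env [p]) (fenv [b; q]) as n IH.
  - apply or_I1. exact (scan_0 _ H).
  - oc IH as E | E; [|now apply or_I2].
    oc (eq_dec G (b · snoc p n) NZero) as D | D.
    + apply or_I2, ex_I with n. now split.
    + apply or_I1; onorm. now rewrite (scan_miss H D).
Qed.

Lemma lcrs_snoc G p i : eqn G (lcrs q (snoc p i)) (q · ⟨p, i⟩).
Proof. unfold lcrs. now rewrite par_snoc, last_snoc. Qed.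

Lemma lcrs_cases G u :
  frc G (scan b q) ->
  frc G (oor (lcrs q u ≐ par u)
    (oex (fun i => oand (lt i (last u)) (lcrs q u ≐ snoc (par u) i)))).
Proof. exact (scan_form (p := par u) (j := last u)). Qed.

(** A node has at most one first child and at most one next sibling. The hypothesis on parents keeps
    these two cases apart, since both have the same predecessor. *)
Lemma lcrs_inj G u v :
  frc G (scan b q) -> eqn G (b · u) NZero -> eqn G (b · v) NZero ->
  frc G (onot (u ≐ NZero)) -> frc G (onot (v ≐ NZero)) ->
  eqn G (par u) (par v) -> eqn G (lcrs q u) (lcrs q v) -> eqn G u v.
Proof.
  intros H Hu Hv Nu Nv P E.
  oc (snoc_cases G u) as Eu | Eu; [exact (bot_E _ (imp_E Nu Eu))|].
  oc (snoc_cases G v) as Ev | Ev; [exact (bot_E _ (imp_E Nv Ev))|].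
  rewrite Eu in Hu. rewrite Ev in Hv. unfold lcrs in E. rewrite P in E, Hu.
  rewrite Eu, Ev, P. now rewrite (scan_inj H Hu Hv E).
Qed.

(** A node of the new spread is a path, coded as the sequence of old nodes visited after the root;
    since [last NZero] is [NZero], the empty path stands at the root. Nonemptiness of [v] is
    required because [lcrs q NZero] is [NZero], so that the root would otherwise succeed itself. *)
Definition tree b' : Om T :=
  oand (b' · NZero ≐ NZero) (oall (fun s => oall (fun v =>
    oiff (b' · snoc s v ≐ NZero)
      (oand (b' · s ≐ NZero) (oand (b · v ≐ NZero)
        (oand (lcrs q v ≐ last s) (onot (v ≐ NZero)))))))).

Lemma tree_ex G : frc G (oex (fun b' => tree b')).
Proof.
  assert (E : frc G (oex (fun g => oall (fun x => g · x ≐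
      add (add (FCst pK · x) (b · last (FCst pL · x)))
        (add (dist (lcrs q (last (FCst pL · x))) (last (par (FCst pL · x))))
          (minus (Sc NZero) (last (FCst pL · x))))))))
    by exact (fun_ex
      (let last t := FCst pL · (FCst pPred · t) in
       let par t := FCst pInit · t in
       let plus t u := FCst pAdd · ⟨t, u⟩ in
       let sub t u := FCst pSub · ⟨t, u⟩ in
       let x := FCst pL · #0 in
       let t := $1 · ⟨par (last x), last (last x)⟩ in
       let u := last (par x) in
       plus (plus (FCst pK · #0) ($0 · last x))
         (plus (plus (sub t u) (sub u t)) (sub (Sc NZero) (last x))))
      (env []) (fenv [b; q]) G).
  od E as g Hg. od (seqrec_ex G g) as b' (H0 & HS). apply ex_I with b'.
  split; auto. intros s v. specialize (HS s v). onorm.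
  rewrite (Hg _ : eqn G _ _), app_pK, !app_pL, par_snoc, !last_snoc in HS.
  split; oi H.
  - rewrite HS in H. apply add_eq_0 in H as [H1 H2].
    apply add_eq_0 in H1 as [H1 H3]. apply add_eq_0 in H2 as [H2 H4].
    repeat split; auto.
    + now apply dist_0.
    + oi K. rewrite K, minus_0_r in H4. exact (Sc_neq0 _ H4).
  - destruct H as (H1 & H2 & H3 & H4); onorm. od (not_0 H4) as x Hx.
    rewrite HS, H1, H2, H3, dist_diag, Hx, minus_SS, minus_0_l. now rewrite !add_0_r.
Qed.

Lemma tree_last G b' s :
  frc G (tree b') -> eqn G (b · NZero) NZero -> eqn G (b' · s) NZero ->
  eqn G (b · last s) NZero.
Proof.
  intros [_ H] H0 K. oc (snoc_cases G s) as E | E.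
  - now rewrite E, last_0.
  - rewrite E in K. exact (proj1 (proj2 (iff1 (H _ _) K))).
Qed.

(** A next sibling may be missing, but the spread-law of [b] always provides a first child to move
    to. *)
Lemma tree_spreadlaw G b' :
  frc G (scan b q) -> frc G (tree b') -> eqn G (b · NZero) NZero ->
  frc G (spreadlaw b) -> frc G (spreadlaw b').
Proof.
  intros HQ H H0 HS s; split; oi K.
  - pose proof (tree_last H H0 K) as L. od (iff1 (HS _) L) as n Hn.
    od (scan_child HQ Hn) as i (E & Hi). onorm.
    apply ex_I with (snoc (last s) i). apply (iff2 (proj2 H _ _)).
    repeat split; auto.
    + onorm. now rewrite lcrs_snoc.
    + oi M. exact (Sc_neq0 _ M).
  - od K as v Hv. exact (proj1 (iff1 (proj2 H _ _) Hv)).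
Qed.

Lemma path_ex G b' v :
  frc G (scan b q) -> frc G (tree b') -> frc G (spreadlaw b) -> eqn G (b · v) NZero ->
  frc G (oex (fun s => oand (b' · s ≐ NZero) (last s ≐ v))).
Proof.
  intros HQ H HS. apply imp_E.
  osind v with ($0 · #0 ≈ NZero ⇒ ∃₀ ($1 · #0 ≈ NZero ∧ FCst pL · (FCst pPred · #0) ≈ #1))
    (env []) (fenv [b; b']) as p i IH; oi K.
  - apply ex_I with NZero. split; [apply H|exact (last_0 G)].
  - assert (Kp : eqn G (b · p) NZero).
    { apply (iff2 (HS p)). now apply ex_I with i. }
    apply (fun X => imp_E X Kp) in IH.
    assert (M : frc G (oex (fun s => oand (b' · s ≐ NZero) (last s ≐ q · ⟨p, i⟩)))).
    { clear K.
      oind i with (∃₀ ($1 · #0 ≈ NZero ∧ FCst pL · (FCst pPred · #0) ≈ $2 · ⟨#2, #1⟩))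
        (env [p]) (fenv [b; b'; q]) as j IHj.
      - od IH as s (E & E'). onorm. apply ex_I with s. split; onorm; auto.
        now rewrite (scan_0 _ HQ).
      - oc (eq_dec G (b · snoc p j) NZero) as D | D.
        + od IHj as s (E & E'). onorm. apply ex_I with (snoc s (snoc p j)). split; onorm.
          * apply (iff2 (proj2 H _ _)). repeat split; auto.
            -- onorm. now rewrite lcrs_snoc.
            -- oi M. exact (Sc_neq0 _ M).
          * now rewrite last_snoc, (scan_hit HQ D).
        + od IHj as s (E & E'). onorm. apply ex_I with s. split; onorm; auto.
          now rewrite (scan_miss HQ D). }
    od M as s (E & E'). onorm. apply ex_I with (snoc s (snoc p i)). split; onorm.
    + apply (iff2 (proj2 H _ _)). repeat split; auto.
      * onorm. now rewrite lcrs_snoc.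
      * oi M. exact (Sc_neq0 _ M).
    + now rewrite last_snoc.
Qed.

(** * Counting the nodes of a level *)

(** [w s] reads the path [s] as a binary numeral, with digit [0] for a move to
    a child and digit [1] for a move to a sibling. *)
Definition word w : Om T :=
  oand (w · NZero ≐ NZero) (oall (fun s => oall (fun v =>
    w · snoc s v ≐ add (add (w · s) (w · s)) (FCst pSg · dist (par v) (last s))))).

Lemma word_ex G : frc G (oex (fun w => word w)).
Proof.
  assert (E : frc G (oex (fun g => oall (fun x => g · x ≐
      add (add (FCst pK · x) (FCst pK · x))
       (FCst pSg · dist (par (last (FCst pL · x))) (last (par (FCst pL · x))))))))
    by exact (fun_ex
      (let last t := FCst pL · (FCst pPred · t) in
       let par t := FCst pInit · t in
       let plus t u := FCst pAdd · ⟨t, u⟩ in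
       let sub t u := FCst pSub · ⟨t, u⟩ in
       let x := FCst pL · #0 in
       let t := par (last x) in
       let u := last (par x) in
       plus (plus (FCst pK · #0) (FCst pK · #0)) (FCst pSg · plus (sub t u) (sub u t)))
      (env []) (fenv []) G).
  od E as g Hg. od (seqrec_ex G g) as w (H0 & HS). apply ex_I with w.
  split; auto. intros s v. specialize (HS s v). onorm.
  now rewrite (Hg _ : eqn G _ _), app_pK, !app_pL, par_snoc, !last_snoc in HS.
Qed.
End Scan.

Lemma pow_0 G : eqn G (pow NZero) (Sc NZero).
Proof.
  unfold pow, pPow. now rewrite app_pComp, app_pPair, app_pZ, app_pI, app_pRec0, app_pComp, app_pZ.
Qed.
Lemma pow_S G n : eqn G (pow (Sc n)) (add (pow n) (pow n)).
Proof.
  unfold pow, pPow.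
  now rewrite !app_pComp, !app_pPair, !app_pZ, !app_pI, app_pRecS, app_pComp, app_pPair, app_pL.
Qed.

Lemma sg_cases G t :
  frc G (oor (oand (FCst pSg · t ≐ NZero) (t ≐ NZero))
    (oand (FCst pSg · t ≐ Sc NZero) (onot (t ≐ NZero)))).
Proof.
  oc (zero_or_S G t) as H | H.
  - apply or_I1. split; onorm; auto. rewrite H. apply sg_0.
  - od H as x Hx. apply or_I2. split; onorm.
    + rewrite Hx. apply sg_S.
    + exact (neq_0 Hx).
Qed.
Arguments sg_cases G t : clear implicits.

Lemma sg_le_1 G t : frc G (le (FCst pSg · t) (Sc NZero)).
Proof.
  oc (sg_cases G t) as [H _] | [H _]; onorm; rewrite H; [apply le_0|apply le_refl].
Qed.
Arguments sg_le_1 G t : clear implicits.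

Lemma le_add G t t' u u' : frc G (le t t') -> frc G (le u u') -> frc G (le (add t u) (add t' u')).
Proof. intros H K. unfold le. rewrite <- add_S_l. now apply lt_add. Qed.

Lemma double_lt G x c y :
  frc G (le c (Sc NZero)) -> frc G (lt x y) -> frc G (lt (add (add x x) c) (add y y)).
Proof.
  intros H L. rewrite add_assoc. apply lt_add; auto.
  apply le_trans with (add x (Sc NZero)).
  - now apply le_add; [apply le_refl|].
  - rewrite add_S_r, add_0_r. now apply lt_le_S.
Qed.

Lemma double_le G x c y c' (P : Om T) :
  frc G (le c (Sc NZero)) -> frc G (lt x y) ->
  eqn G (add (add x x) c) (add (add y y) c') -> frc G P.
Proof.
  intros H L E. pose proof (double_lt H L) as K. rewrite E in K.
  exact (lt_irrefl _ (le_lt_trans (le_add_l _ _ _) K)).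
Qed.

Lemma double_inj G x c y c' :
  frc G (le c (Sc NZero)) -> frc G (le c' (Sc NZero)) ->
  eqn G (add (add x x) c) (add (add y y) c') -> eqn G x y /\ eqn G c c'.
Proof.
  intros H H' E. assert (K : eqn G x y).
  { oc (trichotomy G x y) as L | L.
    - exact (double_le _ H L E).
    - oc L as L | L; auto. symmetry in E. exact (double_le _ H' L E). }
  split; auto. rewrite K in E. now apply add_cancel_l in E.
Qed.

Lemma word_bound G w s : frc G (word w) -> frc G (lt (w · s) (pow (len s))).
Proof.
  intros [H0 HS]; onorm.
  osind s with (Lt ($0 · #0) (FCst pPow · len #0)) (env []) (fenv [w]) as s v IH.
  - rewrite H0, len_0, pow_0. apply lt_succ.
  - rewrite (HS s v : eqn G _ _), len_snoc, pow_S. apply double_lt; auto. apply sg_le_1.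
Qed.

(** By induction on the path: equal words have equal last digits, and the digit determines whether
    the next node is the first child or the next sibling of the current one. *)
Lemma word_inj G b q b' w s t :
  frc G (scan b q) -> frc G (tree b q b') -> frc G (word w) ->
  eqn G (b' · s) NZero -> eqn G (b' · t) NZero -> eqn G (len s) (len t) ->
  eqn G (w · s) (w · t) -> eqn G s t.
Proof.
  intros HQ H HW.
  enough (K : frc G (oall (fun t => oimp (b' · s ≐ NZero) (oimp (b' · t ≐ NZero)
    (oimp (len s ≐ len t) (oimp (w · s ≐ w · t) (s ≐ t))))))).
  { intros K1 K2 K3 K4. exact (imp_E (imp_E (imp_E (imp_E (K t) K1) K2) K3) K4). }
  clear t.
  osind s with (∀₀ ($0 · #1 ≈ NZero ⇒ $0 · #0 ≈ NZero ⇒ len #1 ≈ len #0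
    ⇒ $1 · #1 ≈ $1 · #0 ⇒ #1 ≈ #0)) (env []) (fenv [b'; w]) as s v IH;
    intros t; oi K1; oi K2; oi K3; oi K4.
  - rewrite len_0 in K3. symmetry. apply len_eq_0. now symmetry.
  - oc (snoc_cases G t) as Et | Et.
    { rewrite Et, len_snoc, len_0 in K3. exact (Sc_neq0 _ K3). }
    set (r := par t) in *. set (u := last t) in *. clearbody r u.
    rewrite Et in K2, K3, K4. rewrite Et. clear Et t. rewrite !len_snoc in K3.
    apply Sc_inj in K3.
    destruct (iff1 (proj2 H _ _) K1) as (A1 & A2 & A3 & A4).
    destruct (iff1 (proj2 H _ _) K2) as (B1 & B2 & B3 & B4). onorm.
    destruct HW as [W0 WS]. rewrite (WS _ _ : eqn G _ _), (WS r u : eqn G _ _) in K4.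
    destruct (double_inj (sg_le_1 _ _) (sg_le_1 _ _) K4) as [E1 E2].
    assert (E : eqn G s r) by exact (imp_E (imp_E (imp_E (imp_E (IH r) A1) B1) K3) E1).
    rewrite E in A3, E2. rewrite E.
    assert (EP : eqn G v u); [|now rewrite EP].
    apply lcrs_inj with b q; auto; [|now rewrite A3, B3].
    (* In each case of equal digits the parents of [u] and [v] agree: two children have the current
       node as parent, and two siblings have its parent. *)
    oc (sg_cases G (dist (par v) (last r))) as [S1 D1] | [S1 D1];
    oc (sg_cases G (dist (par u) (last r))) as [S2 D2] | [S2 D2]; onorm;
    rewrite S1, S2 in E2.
    + apply dist_0 in D1. apply dist_0 in D2. now rewrite D1, D2.
    + exact (Sc_neq0 _ (symmetry E2)).
    + exact (Sc_neq0 _ E2).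
    + oc (lcrs_cases (u := v) HQ) as C1 | C1.
      { apply bot_E, (imp_E D1); onorm. rewrite <- A3, C1. apply dist_diag. }
      oc (lcrs_cases (u := u) HQ) as C2 | C2.
      { apply bot_E, (imp_E D2); onorm. rewrite <- B3, C2. apply dist_diag. }
      od C1 as i (_ & C1). od C2 as j (_ & C2). onorm.
      apply snoc_inj1 with i j. now rewrite <- C1, <- C2, A3, B3.
Qed.

Lemma bounded_dec G h m :
  frc G (oor (oall (fun i => oimp (lt i m) (h · i ≐ NZero)))
    (oex (fun i => oand (lt i m) (onot (h · i ≐ NZero))))).
Proof.
  oind m with ((∀₀ (Lt #0 #1 ⇒ $0 · #0 ≈ NZero)) ∨ ∃₀ (Lt #0 #1 ∧ $0 · #0 ≉ NZero))
    (env []) (fenv [h]) as m IH.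
  - apply or_I1. intros i; oi L. exact (lt_0 _ L).
  - oc IH as IH | IH.
    + oc (eq_dec G (h · m) NZero) as D | D.
      * apply or_I1. intros i; oi L. oc (lt_S_inv L) as M | M.
        -- exact (imp_E (IH i) M).
        -- now rewrite M.
      * apply or_I2, ex_I with m. split; auto. apply lt_succ.
    + apply or_I2. od IH as i (L & N). apply ex_I with i. split; auto. now apply lt_S.
Qed.
Arguments bounded_dec G h m : clear implicits.

Lemma incrseq_lt G m s i j :
  frc G (incrseq m s) -> frc G (lt i j) -> frc G (lt j m) ->
  frc G (lt (nth s i) (nth s j)).
Proof.
  intros [H K] L M. revert L M.
  enough (Q : frc G (oimp (lt i j) (oimp (lt j m) (lt (nth s i) (nth s j)))))
    by (intros L M; exact (imp_E (imp_E Q L) M)).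
  oind j with (Lt #1 #0 ⇒ Lt #0 #2 ⇒ Lt (nth #3 #1) (nth #3 #0))
    (env [i; m; s]) (fenv []) as j IH; oi L; oi M.
  - exact (lt_0 _ L).
  - oc (lt_S_inv L) as N | N.
    + apply lt_trans with (nth s j).
      * refine (imp_E (imp_E IH N) _). exact (lt_trans (lt_succ _ _) M).
      * exact (imp_E (K j) M).
    + rewrite N. exact (imp_E (K j) M).
Qed.

Lemma tree_appfan G b q b' :
  frc G (scan b q) -> frc G (tree b q b') -> eqn G (b · NZero) NZero ->
  frc G (spreadlaw b) -> frc G (appfan b').
Proof.
  intros HQ H H0 HS. split; [now apply tree_spreadlaw with b q|].
  intros n. apply ex_I with (Sc (pow n)). intros s; oi I.
  assert (E : frc G (oex (fun h => oall (fun i =>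
      h · i ≐ add (b' · nth s i) (dist (len (nth s i)) n)))))
    by exact (fun_ex (FCst pAdd · ⟨$0 · nth #2 #0, FCst pAdd ·
      ⟨FCst pSub · ⟨len (nth #2 #0), #1⟩, FCst pSub · ⟨#1, len (nth #2 #0)⟩⟩⟩)
      (env [n; s]) (fenv [b']) G).
  od E as h Hh. oc (bounded_dec G h (Sc (pow n))) as D | D.
  - assert (V : frc G (oall (fun i => oimp (lt i (Sc (pow n)))
      (oand (b' · nth s i ≐ NZero) (len (nth s i) ≐ n))))).
    { intros i; oi L. pose proof (imp_E (D i) L) as E; onorm.
      rewrite (Hh i : eqn G _ _) in E. apply add_eq_0 in E as [E1 E2].
      split; auto. now apply dist_0. }
    od (word_ex (G := G)) as w HW.
    assert (E : frc G (oex (fun f => oall (fun i => f · i ≐ w · nth s i))))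
      by exact (fun_ex ($0 · nth #1 #0) (env [s]) (fenv [w]) G).
    od E as f Hf. apply (pigeonhole (G := G) (m := pow n) (f := f)).
    + intros i; oi L. rewrite (Hf i : eqn G _ _).
      destruct (imp_E (V i) L) as [_ E]; onorm. rewrite <- E. now apply word_bound.
    + intros i j; oi Li; oi Lj; oi E. rewrite (Hf i : eqn G _ _), (Hf j : eqn G _ _) in E.
      destruct (imp_E (V i) Li) as [Ei Ei']. destruct (imp_E (V j) Lj) as [Ej Ej']. onorm.
      assert (M : eqn G (nth s i) (nth s j)).
      { apply word_inj with b q b' w; auto. now rewrite Ei', Ej'. }
      oc (trichotomy G i j) as L | L.
      * exact (lt_neq _ (incrseq_lt I L Lj) M).
      * oc L as L | L; auto. exact (lt_neq _ (incrseq_lt I L Li) (symmetry M)).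
  - od D as i (L & N). apply ex_I with i. split; auto.
    oc (eq_dec G (b' · nth s i) NZero) as Z | Z; [apply or_I2|now apply or_I1].
    oi K. apply (imp_E N); onorm. now rewrite (Hh i : eqn G _ _), Z, K, dist_diag, add_0_r.
Qed.
End Tree.

(** * Infinite branches *)

Section Branches.
Context {T : theory} {HT : BIMTheory T}.
Implicit Types (G : list form) (i j k n p s t u v x y : nterm)
  (a b c d e f g h q w z : fterm).
Local Notation "t ≐ u" := (@oeq T t u) (at level 70).
Local Notation eqn := (@eqn T).
Local Notation frc := (@frc T).

Definition almfan b : Om T :=
  oand (spreadlaw b) (oall (fun s => oall (fun z =>
    oimp (incr z) (oex (fun n => onot (b · snoc s (z · n) ≐ NZero)))))).
Definition inf b g : Om T :=
  oall (fun n => oex (fun s => oand (restr g n s) (b · s ≐ NZero))).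

(** [d] lists the old nodes visited by an infinite path of the new tree, with the root as
    [d · NZero]. *)
Definition branch b q d : Om T :=
  oand (d · NZero ≐ NZero) (oall (fun k =>
    oand (b · (d · Sc k) ≐ NZero)
      (oand (lcrs q (d · Sc k) ≐ d · k) (onot (d · Sc k ≐ NZero))))).

Lemma branch_valid G b q d k :
  frc G (branch b q d) -> eqn G (b · NZero) NZero -> eqn G (b · (d · k)) NZero.
Proof.
  intros [D0 DS] H; onorm. oc (zero_or_S G k) as E | E.
  - now rewrite E, D0.
  - od E as j Ej. rewrite Ej. exact (proj1 (DS j)).
Qed.

Lemma branch_step G b q d k :
  frc G (scan b q) -> frc G (branch b q d) ->
  frc G (oor
    (oand (par (d · Sc k) ≐ d · k) (len (d · Sc k) ≐ Sc (len (d · k))))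
    (oand (par (d · Sc k) ≐ par (d · k)) (oand (len (d · Sc k) ≐ len (d · k))
      (oand (lt (last (d · k)) (last (d · Sc k))) (onot (d · k ≐ NZero)))))).
Proof.
  intros HQ [_ DS]. destruct (DS k) as (_ & E & N); onorm.
  oc (snoc_cases G (d · Sc k)) as S | S; [exact (bot_E _ (imp_E N S))|].
  oc (lcrs_cases (u := d · Sc k) HQ) as C | C.
  - apply or_I1. rewrite E in C. split; onorm; [now symmetry|].
    now rewrite S, len_snoc, C at 1.
  - od C as i (L & C). onorm. rewrite E in C. apply or_I2.
    rewrite C, par_snoc, last_snoc. repeat split; auto.
    + orefl.
    + onorm. now rewrite S, !len_snoc, par_snoc.
    + oi M. exact (Sc_neq0 _ M).
Qed.

Lemma branch_mono G b q d k j :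
  frc G (scan b q) -> frc G (branch b q d) ->
  frc G (le (len (d · k)) (len (d · add k j))).
Proof.
  intros HQ HD.
  oind j with (Le (len ($0 · #1)) (len ($0 · (FCst pAdd · ⟨#1, #0⟩)))) (env [k]) (fenv [d])
    as j IH.
  - rewrite add_0_r. apply le_refl.
  - rewrite add_S_r. oc (branch_step (k := add k j) HQ HD) as (_ & E) | (_ & E & _); onorm;
    rewrite E; auto. now apply lt_S.
Qed.

(** The length never decreases, so if it is the same at both ends there were only sibling moves in
    between, and these keep the parent. *)
Lemma branch_stable G b q d k j :
  frc G (scan b q) -> frc G (branch b q d) ->
  eqn G (len (d · add k j)) (len (d · k)) -> eqn G (par (d · add k j)) (par (d · k)).
Proof.
  intros HQ HD. apply imp_E.
  oind j with (len ($0 · (FCst pAdd · ⟨#1, #0⟩)) ≈ len ($0 · #1)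
    ⇒ FCst pInit · ($0 · (FCst pAdd · ⟨#1, #0⟩)) ≈ FCst pInit · ($0 · #1))
    (env [k]) (fenv [d]) as j IH; oi E.
  - fold (add k NZero). now rewrite add_0_r.
  - fold (par (d · add k (Sc j))). fold (par (d · k)).
    rewrite add_S_r in *. oc (branch_step (k := add k j) HQ HD) as (_ & L) | (P & L & _); onorm;
    rewrite L in E.
    + pose proof (branch_mono (k := k) (j := j) HQ HD) as M. rewrite <- E in M.
      exact (lt_irrefl _ (le_S_lt M)).
    + rewrite P. exact (imp_E IH E).
Qed.

(** While the branch moves among siblings, their last entries increase. The almost-fan condition,
    applied to an increasing sequence that follows them, yields a stage by which the branch must
    have moved to a child. *)
Lemma branch_grows G b q d k :
  frc G (scan b q) -> frc G (branch b q d) -> frc G (almfan b) -> eqn G (b · NZero) NZero ->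
  frc G (oex (fun k' => len (d · k') ≐ Sc (len (d · k)))).
Proof.
  intros HQ HD [_ HA] H0.
  oc (snoc_cases G (d · k)) as S | S.
  (* At the root the next move goes to a child, since the root has no siblings. *)
  { apply ex_I with (Sc k); onorm.
    oc (branch_step (k := k) HQ HD) as (_ & E) | (_ & _ & _ & N); auto.
    exact (bot_E _ (imp_E N S)). }
  (* Enumerates the siblings to the right of [d k] that the branch visits; the
     maximum keeps it increasing after the branch has left them. *)
  assert (E : frc G (oex (fun g => oall (fun x => g · x ≐
      add (Sc (FCst pL · x)) (minus (last (d · add k (Sc (FCst pL · (FCst pK · x)))))
        (Sc (FCst pL · x)))))))
    by exact (fun_ex (FCst pAdd · ⟨Sc (FCst pL · #0),
      FCst pSub · ⟨FCst pL · (FCst pPred · ($0 · (FCst pAdd · ⟨#1, Sc (FCst pL · (FCst pK · #0))⟩))),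
      Sc (FCst pL · #0)⟩⟩) (env [k]) (fenv [d]) G).
  od E as g Hg. od (fun_ex #1 (env [last (d · k)]) (fenv []) G) as f Hf.
  od (rec_ex G f g) as r Hr. destruct (Hr NZero) as [R0 RS]; onorm.
  assert (E : frc G (oex (fun z => oall (fun n => z · n ≐ r · ⟨NZero, n⟩))))
    by exact (fun_ex ($0 · ⟨NZero, #0⟩) (env []) (fenv [r]) G).
  od E as z Hz.
  assert (Z0 : eqn G (z · NZero) (last (d · k))).
  { rewrite (Hz NZero : eqn G _ _), R0. exact (Hf NZero). }
  assert (ZS : frc G (oall (fun j => z · Sc j ≐
    add (Sc (z · j)) (minus (last (d · add k (Sc j))) (Sc (z · j)))))).
  { intros j; onorm. rewrite (Hz _ : eqn G _ _), (RS j : eqn G _ _), (Hg _ : eqn G _ _).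
    now rewrite app_pK, !app_pL, (Hz j : eqn G _ _). }
  clear Hz Hr RS R0 Hg Hf f g r.
  assert (I : frc G (incr z)).
  { intros j. rewrite (ZS j : eqn G _ _). apply le_S_lt, le_add_l. }
  assert (C : frc G (oall (fun j => oor
    (oand (par (d · add k j) ≐ par (d · k)) (oand (len (d · add k j) ≐ len (d · k))
      (z · j ≐ last (d · add k j))))
    (oex (fun k' => len (d · k') ≐ Sc (len (d · k))))))).
  { clear S. intros j.
    oind j with ((FCst pInit · ($0 · (FCst pAdd · ⟨#1, #0⟩)) ≈ FCst pInit · ($0 · #1)
        ∧ len ($0 · (FCst pAdd · ⟨#1, #0⟩)) ≈ len ($0 · #1)
        ∧ $1 · #0 ≈ FCst pL · (FCst pPred · ($0 · (FCst pAdd · ⟨#1, #0⟩))))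
      ∨ ∃₀ len ($0 · #0) ≈ Sc (len ($0 · #2))) (env [k]) (fenv [d; z]) as j IH.
    - apply or_I1. rewrite add_0_r. repeat split; orefl || exact Z0.
    - oc IH as (P & L & Ez) | IH; [onorm|now apply or_I2].
      rewrite add_S_r.
      oc (branch_step (k := add k j) HQ HD) as (_ & L') | (P' & L' & M & _); onorm.
      + apply or_I2, ex_I with (Sc (add k j)); onorm. now rewrite L', L.
      + apply or_I1. repeat split; onorm.
        * now rewrite P'.
        * now rewrite L'.
        * rewrite (ZS j : eqn G _ _), add_S_r, Ez. apply add_minus. now apply lt_le_S. }
  od (imp_E (HA (par (d · k)) z) I) as j N.
  oc (C j) as (P & L & Ez) | K; auto. onorm.
  apply bot_E, (imp_E N); onorm. rewrite Ez, <- P.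
  oc (snoc_cases G (d · add k j)) as S' | S'.
  - rewrite S', len_0, S, len_snoc in L. exact (Sc_neq0 _ (symmetry L)).
  - rewrite <- S'. now apply branch_valid with q.
Qed.

(** The nodes from which the branch moves to a child form a chain of initial parts, one of each
    length, and [c] is their limit. The second conjunct records that each initial part of [c] is
    left by a child move. *)
Lemma branch_inf G b q d :
  frc G (scan b q) -> frc G (branch b q d) -> frc G (almfan b) -> eqn G (b · NZero) NZero ->
  frc G (oex (fun c => oand (inf b c)
    (oall (fun n => oex (fun k => oand (restr c n (d · k)) (par (d · Sc k) ≐ d · k)))))).
Proof.
  intros HQ HD HA H0. pose proof (proj1 HD) as D0; onorm.
  assert (R : frc G (oall (fun n => oex (fun k => len (d · k) ≐ n)))).
  { intros n. oind n with (∃₀ len ($0 · #0) ≈ #1) (env []) (fenv [d]) as n IH.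
    - apply ex_I with NZero; onorm. now rewrite D0, len_0.
    - od IH as k Hk. od (branch_grows (k := k) HQ HD HA H0) as k' Hk'.
      apply ex_I with k'; onorm. now rewrite Hk', Hk. }
  assert (E : frc G (oex (fun f => oall (fun x => f · x ≐
      dist (len (d · (FCst pL · x))) (FCst pK · x)))))
    by exact (fun_ex (FCst pAdd · ⟨FCst pSub · ⟨len ($0 · (FCst pL · #0)), FCst pK · #0⟩,
      FCst pSub · ⟨FCst pK · #0, len ($0 · (FCst pL · #0))⟩⟩) (env []) (fenv [d]) G).
  od E as f Hf.
  assert (S : frc G (oall (fun n => oex (fun k => f · ⟨n, k⟩ ≐ NZero)))).
  { intros n. od (R n) as k Hk. apply ex_I with k; onorm.
    now rewrite (Hf _ : eqn G _ _), app_pK, app_pL, Hk, dist_diag. }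
  apply search_ex in S. od S as e He.
  assert (E1 : frc G (oall (fun n => len (d · (e · n)) ≐ n))).
  { intros n; onorm. pose proof (proj1 (He n)) as E; onorm.
    rewrite (Hf _ : eqn G _ _), app_pK, app_pL in E. now apply dist_0. }
  (* [e · n] is the first stage at which the branch has a node of length [n]. *)
  assert (E2 : frc G (oall (fun n => oall (fun k => oimp (lt k (e · n))
    (onot (len (d · k) ≐ n)))))).
  { intros n k; oi L; oi E. pose proof (imp_E (proj2 (He n) k) L) as N.
    apply (imp_E N); onorm. now rewrite (Hf _ : eqn G _ _), app_pK, app_pL, E, dist_diag. }
  clear He Hf f R.
  (* The first node of length [n + 1] is reached by a child move, from a node of length [n]. *)
  assert (A : frc G (oall (fun n => oex (fun k => oand (e · Sc n ≐ Sc k)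
    (oand (par (d · (e · Sc n)) ≐ d · k) (len (d · k) ≐ n)))))).
  { intros n. pose proof (E1 (Sc n)) as L; onorm.
    oc (zero_or_S G (e · Sc n)) as Z | Z.
    - rewrite Z, D0, len_0 in L. exact (Sc_neq0 _ (symmetry L)).
    - od Z as k Hk. apply ex_I with k. split; auto.
      rewrite Hk in L.
      oc (branch_step (k := k) HQ HD) as (P & L') | (_ & L' & _); onorm; rewrite L in L'.
      + split; onorm; [now rewrite Hk|]. apply Sc_inj. now symmetry.
      + assert (Lk : frc G (lt k (e · Sc n))) by (rewrite Hk; apply lt_succ).
        exact (bot_E _ (imp_E (imp_E (E2 (Sc n) k) Lk) (symmetry L'))). }
  (* The parent of the first node of length [n + 2] has length [n + 1]; its last entry is the one at
     position [n]. *)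
  assert (E : frc G (oex (fun c => oall (fun n => c · n ≐ last (par (d · (e · Sc (Sc n))))))))
    by exact (fun_ex (FCst pL · (FCst pPred · (FCst pInit · ($0 · ($1 · Sc (Sc #0))))))
      (env []) (fenv [d; e]) G).
  od E as c Hc.
  assert (K : frc G (oall (fun n => restr c n (par (d · (e · Sc n)))))).
  { intros n.
    oind n with (Restr $0 #0 (FCst pInit · ($1 · ($2 · Sc #0)))) (env []) (fenv [c; d; e])
      as n IH.
    - od (A NZero) as k (_ & P & L). onorm. rewrite P, (len_eq_0 L). apply restr_0.
    - pose proof (restr_S IH) as M.
      enough (E : eqn G (snoc (par (d · (e · Sc n))) (c · n)) (par (d · (e · Sc (Sc n)))))
        by (rewrite E in M; exact M).
      rewrite (Hc n : eqn G _ _). od (A (Sc n)) as k (Ek & P & L). onorm. rewrite P.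
      (* From the first node of length [n + 1] to the one that is left for a child there are only
         sibling moves, so both have the same parent. *)
      enough (E : eqn G (par (d · k)) (par (d · (e · Sc n)))).
      { rewrite <- E. oc (snoc_cases G (d · k)) as Q | Q; [|onorm; now symmetry].
        rewrite Q, len_0 in L. exact (Sc_neq0 _ (symmetry L)). }
      oc (le_or_lt G (e · Sc n) k) as Le | Le.
      + od (le_ex Le) as j Hj. rewrite <- Hj. apply branch_stable with b q; auto.
        rewrite Hj, L. symmetry. apply E1.
      + exact (bot_E _ (imp_E (imp_E (E2 (Sc n) k) Le) L)). }
  apply ex_I with c. split.
  - intros n. apply ex_I with (par (d · (e · Sc n))). split; [apply K|].
    od (A n) as k (_ & P & _). onorm. rewrite P. now apply branch_valid with q.
  - intros n. od (A n) as k (Ek & P & _). onorm. apply ex_I with k.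
    pose proof (K n) as M; onorm. rewrite P in M. split; auto. onorm. now rewrite <- Ek.
Qed.

(** * The transferred bar *)

Definition thinbar b a : Om T :=
  oand (oall (fun g => oimp (inf b g) (oex (fun n => oex (fun s =>
      oand (restr g n s) (ind a s))))))
    (oall (fun s => oall (fun t =>
      oimp (oand (ind a s) (oand (ind a t) (prefix s t))) (s ≐ t)))).

(** The nodes of a path need not be comparable, as it may move from a node of the
    old bar to a sibling in the old bar; only the moves to a child of a node of
    the old bar give a thin bar. *)
Definition newbar b' q a a' : Om T :=
  oall (fun s => oiff (ind a' s)
    (oand (b' · s ≐ NZero) (oand (onot (s ≐ NZero))
      (oand (lcrs q (last s) ≐ par (last s)) (ind a (par (last s))))))).

Lemma newbar_ex G b' q a : frc G (oex (fun a' => newbar b' q a a')).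
Proof.
  assert (E : frc G (oex (fun a' => oall (fun s => a' · s ≐
      ite (add (add (b' · s) (dist (lcrs q (last s)) (par (last s)))) (minus (Sc NZero) s))
        (a · par (last s)) NZero))))
    by exact (fun_ex
      (let last t := FCst pL · (FCst pPred · t) in
       let par t := FCst pInit · t in
       let plus t u := FCst pAdd · ⟨t, u⟩ in
       let sub t u := FCst pSub · ⟨t, u⟩ in
       let t := $1 · ⟨par (last #0), last (last #0)⟩ in
       let u := par (last #0) in
       FCst pIf · ⟨⟨$2 · u, NZero⟩,
         plus (plus ($0 · #0) (plus (sub t u) (sub u t))) (sub (Sc NZero) #0)⟩)
      (env []) (fenv [b'; q; a]) G).
  od E as a' Ha. apply ex_I with a'. intros s. pose proof (Ha s) as E; onorm. clear Ha.
  set (x := add (add _ _) _) in E. split; oi H.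
  - unfold ind in H. rewrite E in H. oc (zero_or_S G x) as Z | Z.
    + rewrite ite_0 in H by exact Z. apply add_eq_0 in Z as [Z1 Z3].
      apply add_eq_0 in Z1 as [Z1 Z2]. repeat split; auto.
      * oi K. rewrite K, minus_0_r in Z3. exact (Sc_neq0 _ Z3).
      * now apply dist_0.
    + od Z as y Hy. apply bot_E, (imp_E H). exact (ite_S _ _ Hy).
  - destruct H as (H1 & H2 & H3 & H4); onorm. od (not_0 H2) as y Hy.
    unfold ind. rewrite E, ite_0; auto.
    unfold x. now rewrite H1, H3, dist_diag, Hy, minus_SS, minus_0_l, !add_0_r.
Qed.

(** Along a path the parent of the current node only gets extended: a sibling move keeps it and a
    child move replaces it by the current node. *)
Lemma tree_extends G b q b' s v t :
  frc G (scan b q) -> frc G (tree b q b') ->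
  eqn G (par (last s)) v -> frc G (onot (s ≐ NZero)) ->
  eqn G (b' · t) NZero -> frc G (prefix s t) -> frc G (prefix v (par (last t))).
Proof.
  intros HQ H E N K1 K2. revert K1 K2.
  enough (K : frc G (oimp (b' · t ≐ NZero) (oimp (prefix s t) (prefix v (par (last t))))))
    by (intros K1 K2; exact (imp_E (imp_E K K1) K2)).
  osind t with ($0 · #0 ≈ NZero ⇒ Prefix #1 #0
     ⇒ Prefix #2 (FCst pInit · (FCst pL · (FCst pPred · #0))))
    (env [s; v]) (fenv [b']) as t x IH; oi K1; oi K2.
  - destruct K2 as [L _]; onorm. rewrite len_0 in L. apply bot_E, (imp_E N).
    apply len_eq_0. now apply le_antisym; [|apply le_0].
  - destruct (iff1 (proj2 H _ _) K1) as (B & _ & P & M). onorm. rewrite last_snoc.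
    oc (prefix_snoc_inv K2) as K | K.
    + pose proof (imp_E (imp_E IH B) K) as Q. rewrite <- P in Q.
      oc (lcrs_cases (u := x) HQ) as C | C.
      * rewrite C in Q. now apply prefix_par.
      * od C as i (_ & C). onorm. now rewrite C, par_snoc in Q.
    + rewrite K, last_snoc in E. rewrite E. apply prefix_refl.
Qed.

(** Bar: the member [c] of the old spread determined by a branch meets the old bar at a visited
    node, and the next move goes to a child. Thinness: if [s] is a proper initial part of [t], the
    old bar nodes left by their last moves are comparable, hence equal, although the path had
    already passed below the first one. *)
Lemma newbar_thinbar G b q b' a a' :
  frc G (scan b q) -> frc G (tree b q b') -> frc G (newbar b' q a a') ->
  frc G (almfan b) -> eqn G (b · NZero) NZero ->
  frc G (thinbar b a) -> frc G (thinbar b' a').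
Proof.
  intros HQ H HN HA H0 [HB HT']. split.
  - intros g; oi I.
    assert (E : frc G (oex (fun f => oall (fun x => f · x ≐ g · (FCst pL · (FCst pK · x))))))
      by exact (fun_ex ($0 · (FCst pL · (FCst pK · #0))) (env []) (fenv [g]) G).
    od E as f Hf. od (rec_ex G (FCst pZ) f) as r Hr. destruct (Hr NZero) as [R0 RS]; onorm.
    assert (E : frc G (oex (fun d => oall (fun n => d · n ≐ r · ⟨NZero, n⟩))))
      by exact (fun_ex ($0 · ⟨NZero, #0⟩) (env []) (fenv [r]) G).
    od E as d Hd.
    assert (D0 : eqn G (d · NZero) NZero).
    { now rewrite (Hd NZero : eqn G _ _), R0, app_pZ. }
    (* [d] is [g] preceded by the root. *)
    assert (DS : frc G (oall (fun k => d · Sc k ≐ g · k))).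
    { intros k; onorm. rewrite (Hd _ : eqn G _ _), (RS k : eqn G _ _), (Hf _ : eqn G _ _).
      now rewrite app_pK, app_pL. }
    clear Hd Hr RS R0 Hf f r.
    assert (L : frc G (oall (fun k => oall (fun s => oimp (restr g k s) (last s ≐ d · k))))).
    { intros k s; oi R. oc (zero_or_S G k) as Z | Z.
      - rewrite Z in R. destruct R as [R _]; onorm.
        now rewrite Z, (len_eq_0 R), last_0, D0.
      - od Z as j Hj. rewrite Hj in R. od (restr_S_inv R) as s' (_ & E). onorm.
        now rewrite E, last_snoc, Hj, (DS j : eqn G _ _). }
    assert (HD : frc G (branch b q d)).
    { split; auto. intros k. od (I (Sc k)) as s (R & B).
      od (restr_S_inv R) as s' (R' & E). onorm. rewrite E in B.
      destruct (iff1 (proj2 H _ _) B) as (_ & B1 & B2 & B3). onorm.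
      rewrite (imp_E (L k s') R' : eqn G _ _) in B2. rewrite (DS k : eqn G _ _).
      repeat split; auto. }
    od (branch_inf HQ HD HA H0) as c (IC & KC).
    od (imp_E (HB c) IC) as n X. od X as s (R & A). od (KC n) as k (R' & P). onorm.
    pose proof (restr_uniq R R') as E. rewrite E in A.
    (* Length [Sc k], so that the path ends with the child move out of the bar node [d · k]. *)
    od (I (Sc k)) as t (Rt & Bt). onorm. apply ex_I with (Sc k), ex_I with t.
    split; auto. apply (iff2 (HN t)).
    pose proof (imp_E (L (Sc k) t) Rt) as Lt; onorm. rewrite Lt.
    repeat split; auto.
    + oi Z. rewrite Z in Rt. destruct Rt as [Rt _]; onorm. rewrite len_0 in Rt.
      exact (Sc_neq0 _ (symmetry Rt)).
    + onorm. rewrite P. exact (proj1 (proj2 (proj2 HD k))).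
    + now rewrite P.
  - intros s t; oi X. destruct X as (As & At & Pst).
    destruct (iff1 (HN s) As) as (S1 & S2 & S3 & S4).
    destruct (iff1 (HN t) At) as (T1 & T2 & T3 & T4). onorm.
    oc (snoc_cases G t) as Et | Et; [exact (bot_E _ (imp_E T2 Et))|].
    set (y := par t) in *. set (x := last t) in *.
    pose proof Pst as Pst'. rewrite Et in Pst'.
    oc (prefix_snoc_inv Pst') as P | P; [|onorm; now rewrite P].
    rewrite Et in T1. destruct (iff1 (proj2 H _ _) T1) as (B & _ & Q & _). onorm.
    rewrite T3 in Q.
    assert (M : frc G (prefix (par (last s)) (par (last y)))).
    { apply tree_extends with b q b' s; auto. reflexivity. }
    rewrite Q in T4.
    assert (E : eqn G (par (last s)) (last y)).
    { apply (imp_E (HT' (par (last s)) (last y))). repeat split; auto; now apply prefix_par. }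
    (* Now [last y] would be an initial part of its own parent. *)
    rewrite E in M. destruct M as [M _]; onorm. apply bot_E.
    oc (snoc_cases G y) as Ey | Ey.
    { destruct P as [P _]; onorm. rewrite Ey, len_0 in P. apply (imp_E S2). apply len_eq_0.
      now apply le_antisym; [|apply le_0]. }
    rewrite Ey in B. destruct (iff1 (proj2 H _ _) B) as (_ & _ & _ & N).
    oc (snoc_cases G (last y)) as Z | Z; [exact (imp_E N Z)|].
    rewrite Z, len_snoc, par_snoc in M. exact (lt_irrefl _ (le_S_lt M)).
Qed.

(** A path that ends at a child of the old bar node [v] has a code larger than [v], and [z] provides
    arbitrarily large [v]. *)
Lemma newbar_unbounded G b q b' a a' z :
  frc G (scan b q) -> frc G (tree b q b') -> frc G (newbar b' q a a') ->
  frc G (spreadlaw b) -> frc G (oall (fun s => oimp (ind a s) (b · s ≐ NZero))) ->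
  frc G (incr z) -> frc G (oall (fun n => ind a (z · n))) ->
  frc G (oall (fun n => oex (fun m => oand (lt n m) (ind a' m)))).
Proof.
  intros HQ H HN HS HV I A n. set (v := z · Sc n).
  pose proof (imp_E (HV v) (A (Sc n))) as Bv; onorm.
  od (path_ex HQ H HS Bv) as s (Bs & Ls). od (iff1 (HS v) Bv) as m Hm.
  od (scan_child HQ Hm) as i (Q & Bi). onorm.
  apply ex_I with (snoc s (snoc v i)). split.
  - apply lt_trans with v; [apply le_S_lt; now apply incr_le|].
    apply lt_trans with (snoc v i); [apply lt_snoc_l|apply lt_snoc_r].
  - apply (iff2 (HN _)). rewrite last_snoc, par_snoc, lcrs_snoc. repeat split; auto.
    + onorm. apply (iff2 (proj2 H _ _)). rewrite lcrs_snoc. repeat split; auto.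
      * onorm. now rewrite Q, Ls.
      * oi M. exact (Sc_neq0 _ M).
    + oi M. exact (Sc_neq0 _ M).
    + exact (A (Sc n)).
Qed.

Lemma spread_nil G b s : frc G (spreadlaw b) -> eqn G (b · s) NZero -> eqn G (b · NZero) NZero.
Proof.
  intros H. apply imp_E.
  osind s with ($0 · #0 ≈ NZero ⇒ $0 · NZero ≈ NZero) (env []) (fenv [b]) as s n IH; oi K; auto.
  apply (imp_E IH). apply (iff2 (H s)). now apply ex_I with n.
Qed.

(** * From approximate fans to almost-fans *)

Definition appft : Om T :=
  oall (fun b => oall (fun a => oimp (oand (appfan b) (oand (thinbar b a)
    (oall (fun s => oimp (ind a s) (b · s ≐ NZero))))) (almfin a))).

Theorem almft G b a :
  frc G mp1 -> frc G appft -> frc G (almfan b) -> frc G (thinbar b a) ->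
  frc G (oall (fun s => oimp (ind a s) (b · s ≐ NZero))) -> frc G (almfin a).
Proof.
  intros MP FT HA HB HV z; oi I.
  assert (E : frc G (oex (fun f => oall (fun n => f · n ≐ minus (Sc NZero) (a · (z · n))))))
    by exact (fun_ex (FCst pSub · ⟨Sc NZero, $0 · ($1 · #0)⟩) (env []) (fenv [a; z]) G).
  od E as f Hf.
  enough (Q : frc G (oex (fun n => ind f n))).
  { od Q as n Hn. apply ex_I with n. apply notnot_I. unfold ind in Hn.
    rewrite (Hf n : eqn G _ _) in Hn. oc (zero_or_S G (a · (z · n))) as D | D; auto.
    od D as y Hy. apply bot_E, (imp_E Hn); onorm. now rewrite Hy, minus_SS, minus_0_l. }
  (* [f · n] is nonzero exactly when [z · n] lies outside [D_a]; it remains to refute that the whole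
     range of [z] lies in [D_a]. *)
  apply (imp_E (MP f)). oi N.
  assert (A : frc G (oall (fun n => ind a (z · n)))).
  { intros n; oi Z. apply (imp_E N). apply ex_I with n. unfold ind.
    apply neq_0 with NZero. now rewrite (Hf n : eqn G _ _), Z, minus_0_r. }
  pose proof (proj1 HA) as HS.
  assert (H0 : eqn G (b · NZero) NZero).
  { exact (spread_nil HS (imp_E (HV _) (A NZero))). }
  od (scan_ex (G := G) (b := b)) as q HQ. od (tree_ex (G := G) (b := b) (q := q)) as b' H.
  od (newbar_ex (G := G) (b' := b') (q := q) (a := a)) as a' HN.
  apply (unbounded_not_almfin (a := a')).
  - now apply newbar_unbounded with b q b' a z.
  - apply (imp_E (FT b' a')). split; [|split].
    + exact (tree_appfan HQ H H0 HS).
    + exact (newbar_thinbar HQ H HN HA H0 HB).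
    + intros s; oi X. exact (proj1 (iff1 (HN s) X)).
Qed.
End Branches.

(** The two added axioms are closed formulas, on which substitution acts trivially. *)
Lemma AppFT_theory : BIMTheory (BIM ⊕ MP1 ⊕ AppFT).
Proof.
  split.
  - intros A H; left; now left.
  - intros sigma tau A [[H| ->]| ->].
    + left; left. now apply BIM_sub_closed.
    + left; right; reflexivity.
    + right; reflexivity.
Qed.

Lemma AppFT_AlmFT : BIM ⊕ MP1 ⊕ AppFT ⊢ AlmFT.
Proof.
  pose proof AppFT_theory as HT. apply ev_intro.
  assert (MP : frc nil (@mp1 (BIM ⊕ MP1 ⊕ AppFT))).
  { apply (ev_ax (A := MP1)). left; right; reflexivity. }
  assert (FT : frc nil (@appft (BIM ⊕ MP1 ⊕ AppFT))).
  { apply (ev_ax (A := AppFT)). right; reflexivity. }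
  change (frc nil (oall (fun b => oall (fun a => oimp (oand (@almfan (BIM ⊕ MP1 ⊕ AppFT) b)
    (oand (thinbar b a) (oall (fun s => oimp (ind a s) (oeq (b · s) NZero))))) (almfin a))))).
  intros b a; oi H. destruct H as (H1 & H2 & H3). now apply almft with b.
Qed.

Theorem theorem11p4 :
  (BIM ⊢ (MP1 ⇔ ∀₁ (AlmostFinite $0 ⇔ NotNotFinite $0)))
  /\ (BIM ⊕ MP1 ⊕ AppFT ⊢ AlmFT).
Proof. exact (conj MP1_iff_almost_finite AppFT_AlmFT). Qed.
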